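(* For any non-empty compact convex subset $C\subset\mathbb{R}^2$ there exists a Levi potential $U:\mathbb{R}^2\to\mathbb{R}$ with critical set $\mathrm{crit}(U)=C$.
   Context: Smooth means $C^\infty$. Let $U:\mathbb{R}^2\to\mathbb{R}$ be smooth. A level orbit of $U$ is a solution $q:I\to\mathbb{R}^2$ of the Newton equation $\ddot q=-\nabla U(q)$, defined on a maximal time interval $I\subset\mathbb{R}$, such that $s\mapsto U(q(s))$ is constant on $I$ (constant solutions sitting at critical points of $U$ are allowed). A Levi potential is a smooth function $U:\mathbb{R}^2\to\mathbb{R}$ such that every point of $\mathbb{R}^2$ lies on a level orbit of $U$. The critical set is $\mathrm{crit}(U)=\{x\in\mathbb{R}^2 : \nabla U(x)=0\}$. *)

(* Defs.v *)
From mathcomp Require Import all_boot all_order all_algebra.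
From mathcomp Require Import all_classical all_reals all_analysis.

Set Implicit Arguments.
Unset Strict Implicit.
Unset Printing Implicit Defensive.

Import Order.TTheory GRing.Theory Num.Theory.
Import numFieldNormedType.Exports.

Local Open Scope ring_scope.
Local Open Scope classical_set_scope.

Definition partial (R : realType) (n : nat) (i : 'I_n) (f : 'rV[R]_n -> R) :
  'rV[R]_n -> R := fun x => 'D_(delta_mx 0 i) f x.

Definition grad (R : realType) (n : nat) (f : 'rV[R]_n -> R) (x : 'rV[R]_n) :
  'rV[R]_n := \row_(i < n) partial i f x.

(* 'D_v f is a total operator, so the existence of each partial derivative is
   required explicitly. *)
Fixpoint class_C (R : realType) (n k : nat) (f : 'rV[R]_n -> R) : Prop :=
  continuous f /\
  if k is k'.+1 then
    forall i : 'I_n,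
      (forall x, derivable f x (delta_mx 0 i)) /\ class_C k' (partial i f)
  else True.

Definition smooth (R : realType) (n : nat) (f : 'rV[R]_n -> R) : Prop :=
  forall k, class_C k f.

Definition crit (R : realType) (n : nat) (U : 'rV[R]_n -> R) :
  set 'rV[R]_n := [set x | grad U x = 0].

(* A function I -> R^n is encoded by a total q : R -> R^n whose values outside I
   are irrelevant; derivatives at points of I only see q near those points, as I
   is open. Restricting to open I loses nothing for maximal solutions: when U is
   smooth, a solution on an interval containing one of its endpoints extends
   past that endpoint. *)
Definition newton_solution (R : realType) (n : nat) (U : 'rV[R]_n -> R)
    (I : set R) (q : R -> 'rV[R]_n) : Prop :=
  [/\ I !=set0, open I, is_interval I &
      forall t, I t ->
        [/\ derivable q t 1, derivable q^`() t 1 & q^`(2) t = - grad U (q t)]].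

Definition maximal_newton_solution (R : realType) (n : nat)
    (U : 'rV[R]_n -> R) (I : set R) (q : R -> 'rV[R]_n) : Prop :=
  newton_solution U I q /\
  forall (J : set R) (p : R -> 'rV[R]_n),
    I `<=` J -> newton_solution U J p -> {in I, p =1 q} -> J = I.

Definition level_orbit (R : realType) (n : nat) (U : 'rV[R]_n -> R)
    (I : set R) (q : R -> 'rV[R]_n) : Prop :=
  maximal_newton_solution U I q /\
  forall s t, I s -> I t -> U (q s) = U (q t).

Definition Levi_potential (R : realType) (n : nat) (U : 'rV[R]_n -> R) : Prop :=
  smooth U /\
  forall x, exists (I : set R) (q : R -> 'rV[R]_n),
    level_orbit U I q /\ exists2 s, I s & q s = x.

(* Main.v *)
Require Import Defs.
From mathcomp Require Import all_boot all_order all_algebra.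
From mathcomp Require Import all_classical all_reals all_analysis.
From mathcomp Require Import measurable_realfun lebesgue_integral_under ring lra.
Import Order.TTheory GRing.Theory Num.Theory.
Import numFieldNormedType.Exports.

(** Suppose that the level curves of [U] around [C] are strictly convex curves
    [S_lam], where [lam > 0], and that [U] equals [u lam] on [S_lam]. A particle that
    runs along [S_lam] with constant speed [v] has an acceleration of size [v ^ 2 / r]
    towards the inner normal, [r] being the radius of curvature. It solves the Newton
    equation as soon as [v ^ 2 / r] is the size of the gradient of [U] at every point
    of [S_lam]. Equivalently, the normal distance to the next curve is proportional to
    [r]: the curves have to move by inverse curvature flow. In terms of the support
    function [h th], whose curvature radius is [h + h''], this flow is the linear
    equation [h_t = h + h''], a heat equation up to the factor [exp t].

    So let [h0] be the support function of [C] and let [h] solve this equation, with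
    time [t = lam ^ 2 / 4], from the initial value [h0]: [h] is [supp], a Gaussian
    convolution of [h0]. Convexity of [C] is the weak inequality [h0 + h0'' >= 0]. The
    convolution turns it into the quantitative bound [rho_lower_bound] on the curvature
    radius, as soon as [C] has positive perimeter. Hence the curves [S_lam] are smooth,
    strictly convex and strictly nested. They shrink to [C] when [lam] tends to [0], and
    they fill the complement of [C] ([exists_polar], [polar_unique]). The normal angle
    and the scale [lam] are therefore coordinates off [C], and [polar_derive] expresses
    their derivatives by the support function.

    It remains to make [U] smooth across the boundary of [C]. Take
    [u lam = exp (- lam ^ -4)], and [U = 0] on [C]. In the coordinates all derivatives of
    [U] are [u lam] times functions that grow at most like [exp (K / lam ^ 2)]: these
    are the functions called [tame]. The distance to [C] is at least of order
    [lam * exp (- K' / lam ^ 2)]. As [lam ^ -4] dominates [lam ^ -2], every such product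
    is of second order in the distance to [C] ([pot_small]), so it is continuous with
    zero derivative on [C], and induction gives smoothness ([class_C_pot]). The gradient
    vanishes exactly on [C]; points of [C] are rest points, and through every other
    point passes a level orbit running around its curve [S_lam] ([level_orbit_off]).

    If [C] is a single point, its perimeter is zero and the flow does not move it.
    Then the potential of an isotropic harmonic oscillator works, whose orbits include
    all uniform circular motions around the centre ([Levi_point]). *)

Set Implicit Arguments.
Unset Strict Implicit.
Unset Printing Implicit Defensive.

Local Open Scope ring_scope.
Local Open Scope classical_set_scope.

(** * Mean value theorems on the line *)

Section calculus.
Context {R : realType}.
Implicit Types (f df : R -> R) (a b x : R).

Lemma is_derive_continuous f x (l : R) : is_derive x 1 f l -> {for x, continuous f}.
Proof. by move=> [fx _]; exact/differentiable_continuous/derivable1_diffP. Qed.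

Lemma mvt f df a b : a < b ->
  (forall x, a <= x <= b -> is_derive x 1 f (df x)) ->
  exists2 c, a < c < b & f b - f a = df c * (b - a).
Proof.
move=> ab dfx; have [||c cab ->] := @MVT R f df a b ab.
- by move=> x; rewrite in_itv /= => /andP[? ?]; apply: dfx; rewrite !ltW.
- apply: derivable_within_continuous => x; rewrite in_itv /= => xab.
  by case: (dfx x xab).
- by exists c => //; move: cab; rewrite in_itv.
Qed.

(** The increment formula for an unordered pair of points. The derivative is only needed
    to the right of the smaller point, so that functions of a positive scale qualify. *)
Lemma mvt_between f df a b :
  (forall x, Num.min a b <= x -> is_derive x 1 f (df x)) ->
  exists2 c, `|c - a| <= `|b - a| & Num.min a b <= c /\ f b - f a = df c * (b - a).
Proof.
move=> +; case: ltgtP => [ab|ba|->] dfx.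
- have [|c /andP[ac cb] E] := @mvt f df a b ab.
    by move=> x /andP[ax _]; apply: dfx.
  exists c; first by rewrite !gtr0_norm ?subr_gt0 // lerD2r ltW.
  by rewrite ltW.
- have [|c /andP[ac cb] E] := @mvt f df b a ba.
    by move=> x /andP[ax _]; apply: dfx.
  exists c; first by rewrite !ltr0_norm ?subr_lt0 // lerN2 lerD2r ltW.
  rewrite (ltW ac); split => //.
  by rewrite -opprB E -mulrN opprB.
- by exists b; rewrite ?minxx ?subrr ?mulr0.
Qed.

Lemma nondecreasing_derive f df a b : a <= b ->
  (forall x, a <= x <= b -> is_derive x 1 f (df x)) ->
  (forall x, a <= x <= b -> 0 <= df x) -> f a <= f b.
Proof.
rewrite le_eqVlt => /predU1P[-> //|ab] dfx df0.
have [c /andP[ac cb] E] := mvt ab dfx.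
by rewrite -subr_ge0 E mulr_ge0 ?subr_ge0 ?(ltW ab)// df0 // !ltW.
Qed.

Lemma is_derive_inv x : x != 0 -> is_derive x 1 (fun y : R => y^-1) (- x ^- 2).
Proof.
move=> x0; have := @is_deriveV R id x 1 1 x0 (is_derive_id x 1).
by rewrite /GRing.scale /= mulr1.
Qed.

End calculus.

(** * Gaussian integrals *)

Section gaussian_integrals.
Context {R : realType}.
Let mu := @lebesgue_measure R.
Implicit Types (f g : R -> R).

Lemma integrable_dominated f g : continuous f -> (forall x, `|f x| <= g x) ->
  mu.-integrable setT (EFin \o g) -> mu.-integrable setT (EFin \o f).
Proof.
move=> cf fg; apply: le_integrable => //.
  by apply/measurable_EFinP; exact: continuous_measurable_fun.
by move=> x _; rewrite lee_fin (le_trans (fg x))// ler_norm.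
Qed.

Lemma ge0_integral_affine g a b : 0 < a -> continuous g -> (forall x, 0 <= g x) ->
  (\int[mu]_x (g x)%:E = \int[mu]_x (g (a * x + b) * a)%:E)%E.
Proof.
move=> a0 cg g0.
have dF (x : R) : is_derive x 1 (fun y => a * y + b) a.
  by apply: is_derive_eq; rewrite /GRing.scale /=; ring.
have F'E : (fun x => a * x + b)^`() = cst a.
  by apply/funext => x; rewrite derive1E derive_val.
rewrite (@increasing_ge0_integration_by_substitutionT _ (fun x => a * x + b) g) //.
- by rewrite F'E.
- by move=> x y xy; rewrite ltrD2r ltr_pM2l.
- by rewrite F'E => ?; exact: cvg_cst.
- by rewrite F'E; exact: is_cvg_cst.
- by rewrite F'E; exact: is_cvg_cst.
- apply: cvg_comp (cvg_addrr_Ny b) => //.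
  exact: gt0_cvgMrNy.
- apply: cvg_comp (cvg_addrr b) => //.
  exact: gt0_cvgMry.
Qed.

Lemma integrable_affine g a b : 0 < a -> continuous g ->
  mu.-integrable setT (EFin \o g) ->
  mu.-integrable setT (EFin \o (fun x => g (a * x + b))).
Proof.
move=> a0 cg /integrableP[mg ig].
have cga : continuous (fun x => g (a * x + b)).
  move=> x; apply: continuous_comp; last exact: cg.
  by apply: cvgD; [apply: cvgM => //; exact: cvg_cst|exact: cvg_cst].
apply/integrableP; split.
  by apply/measurable_EFinP; exact: continuous_measurable_fun.
move: ig; rewrite (_ : (fun x => _) = (fun x => (`|g x|)%:E)) //.
rewrite (@ge0_integral_affine (fun x => `|g x|) a b) //; last first.
  by move=> x; apply: cvg_norm; exact: cg.
under eq_integral do rewrite EFinM muleC.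
rewrite ge0_integralZl//; last 2 first.
- apply/measurable_EFinP; apply: continuous_measurable_fun => x.
  by apply: cvg_norm; exact: cga.
- by rewrite lee_fin ltW.
apply: contraTT; rewrite -!leNgt !leye_eq => /eqP ->.
by rewrite gt0_muley // lte_fin.
Qed.

Lemma Rintegral_affine g a b : 0 < a -> continuous g ->
  mu.-integrable setT (EFin \o g) ->
  (\int[mu]_x g (a * x + b) = a^-1 * \int[mu]_x g x)%R.
Proof.
move=> a0 cg ig.
have cga : continuous (fun x => g (a * x + b)).
  move=> x; apply: continuous_comp; last exact: cg.
  by apply: cvgD; [apply: cvgM => //; exact: cvg_cst|exact: cvg_cst].
have iga := integrable_affine b a0 cg ig.
have key f : continuous f -> (forall x, 0 <= f x) -> mu.-integrable setT (EFin \o f) ->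
    (\int[mu]_x f (a * x + b) = a^-1 * \int[mu]_x f x)%R.
  move=> cf f0 jf; transitivity (a^-1 * (\int[mu]_x (f (a * x + b) * a))%R); last first.
    by rewrite /Rintegral [in RHS](ge0_integral_affine b a0 cf f0).
  rewrite RintegralZr //; last exact: integrable_affine.
  by rewrite mulrCA mulVf ?mulr1 // gt_eqF.
have cn : continuous (fun x => `|g x|) by move=> x; apply: cvg_norm; exact: cg.
have ign : mu.-integrable setT (EFin \o (fun x => `|g x|)) by exact: integrable_norm.
have cgn : continuous (fun x => `|g x| + g x) by move=> x; apply: cvgD; [exact: cn|exact: cg].
have ip : mu.-integrable setT (EFin \o (fun x => `|g x| + g x)).
  by rewrite /comp; under eq_fun do rewrite EFinD; exact: integrableD.
have gn0 x : 0 <= `|g x| + g x by rewrite -lerBlDr sub0r -normrN ler_norm.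
have := key _ cgn gn0 ip.
have ina := integrable_affine b a0 cn ign.
have n0 x : 0 <= `|g x| by [].
rewrite (RintegralD _ ina iga) // (RintegralD _ ign ig) //.
rewrite mulrDr -(key _ cn n0 ign).
exact: addrI.
Qed.

Lemma Rintegral_le f g : mu.-integrable setT (EFin \o f) -> mu.-integrable setT (EFin \o g) ->
  (forall x, f x <= g x) -> (\int[mu]_x f x <= \int[mu]_x g x)%R.
Proof. by move=> ? ? fg; apply: le_Rintegral. Qed.

Lemma Rintegral_norm_le f g : continuous f -> mu.-integrable setT (EFin \o g) ->
  (forall x, `|f x| <= g x) -> (`|\int[mu]_x f x| <= \int[mu]_x g x)%R.
Proof.
move=> cf ig fg.
have jf := integrable_dominated cf fg ig.
apply: le_trans (Rintegral_le _ ig fg); last exact: integrable_norm.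
exact: le_normr_Rintegral.
Qed.

Lemma integrable_gauss (b c : R) : 0 < b ->
  mu.-integrable setT (EFin \o (fun v : R => expR (- (b * (v - c) ^+ 2)))).
Proof.
move=> b0; have sb : 0 < Num.sqrt b by rewrite sqrtr_gt0.
have := integrable_affine (- (Num.sqrt b * c)) sb (@continuous_gauss_fun R)
  integrableT_gauss.
congr (mu.-integrable setT _); apply/funext => v /=; congr (_%:E).
by rewrite /gauss_fun -mulrBr exprMn sqr_sqrtr // ltW.
Qed.

(** Half of a Gaussian exponent absorbs any monomial; this makes all the moments below
    integrable with Gaussian majorants. *)
Lemma norm_expr_gauss n (b : R) : 0 < b ->
  exists2 A, 0 < A & forall v : R, `|v| ^+ n <= A * expR (b * v ^+ 2).
Proof.
elim: n b => [|n IHn] b b0.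
  by exists 1 => // v; rewrite mul1r expr0 -expR0 ler_expR mulr_ge0 ?sqr_ge0 // ltW.
have b20 : 0 < b / 2 by rewrite divr_gt0.
have [A A0 HA] := IHn (b / 2) b20.
exists (A * (1 + 2 / b)); first by rewrite mulr_gt0 ?addr_gt0 ?divr_gt0.
move=> v; rewrite exprS.
have vle : `|v| <= (1 + 2 / b) * expR (b / 2 * v ^+ 2).
  apply: (@le_trans _ _ ((1 + 2 / b) * (1 + b / 2 * v ^+ 2))); last first.
    by rewrite ler_pM2l ?expR_ge1Dx // addr_gt0 ?divr_gt0.
  have -> : (1 + 2 / b) * (1 + b / 2 * v ^+ 2) = 1 + v ^+ 2 + (2 / b + b / 2 * v ^+ 2).
    by field; rewrite gt_eqF.
  apply: (@le_trans _ _ (1 + v ^+ 2)).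
    rewrite -[v ^+ 2]real_normK ?num_real //.
    by have := sqr_ge0 (`|v| - 1); have := normr_ge0 v; nra.
  rewrite lerDl addr_ge0 //; first by rewrite ltW // divr_gt0.
  by rewrite mulr_ge0 ?sqr_ge0 // ltW.
have -> : A * (1 + 2 / b) * expR (b * v ^+ 2) =
    (1 + 2 / b) * expR (b / 2 * v ^+ 2) * (A * expR (b / 2 * v ^+ 2)).
  have -> : b * v ^+ 2 = b / 2 * v ^+ 2 + b / 2 * v ^+ 2 by field.
  by rewrite expRD; ring.
by rewrite ler_pM // exprn_ge0.
Qed.

Definition gmono n (v : R) : R := v ^+ n * expR (- v ^+ 2).

Lemma is_derive_gmono n (v : R) : is_derive v 1 (gmono n) (n%:R * gmono n.-1 v - 2 * gmono n.+1 v).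
Proof.
rewrite /gmono; case: n => [|n].
  under eq_fun do rewrite expr0 mul1r.
  by apply: is_derive_eq; rewrite /GRing.scale /= expr1; ring.
have dX : is_derive v 1 (fun w : R => w ^+ n.+1) (n.+1%:R * v ^+ n).
  by apply: DeriveDef; [exact: exprn_derivable|rewrite exp_derive /= /GRing.scale /= mulr1].
by apply: is_derive_eq; rewrite /GRing.scale /= !exprS; ring.
Qed.

Lemma continuous_gmono n : continuous (gmono n).
Proof. by move=> v; exact: is_derive_continuous (is_derive_gmono n v). Qed.

Lemma gmono_bound n : exists2 A, 0 < A & forall v, `|gmono n v| <= A * expR (- (2^-1 * v ^+ 2)).
Proof.
have h0 : 0 < (2^-1 : R) by rewrite invr_gt0.
have [A A0 HA] := norm_expr_gauss n h0.
exists A => // v; rewrite /gmono normrM normrX (gtr0_norm (expR_gt0 _)).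
have -> : - v ^+ 2 = - (2^-1 * v ^+ 2) + - (2^-1 * v ^+ 2) by field.
rewrite expRD mulrA ler_pM2r ?expR_gt0 // -ler_pdivlMr ?expR_gt0 //.
by rewrite -expRN opprK.
Qed.
End gaussian_integrals.

(** * Gaussian convolution of a bounded continuous function *)

Section under_integral.
Context {R : realType}.
Let mu := @lebesgue_measure R.

(** Differentiation under the integral sign, with the domination needed only near the
    point where the derivative is taken. *)
Lemma is_derive_under_integral (f df : R -> R -> R) (a d : R) (G : R -> R) : 0 < d ->
  (forall x, a - d < x < a + d -> mu.-integrable setT (EFin \o f x)) ->
  (forall x y, a - d < x < a + d -> is_derive x 1 (f ^~ y) (df x y)) ->
  (forall x y, a - d < x < a + d -> `|df x y| <= G y) ->
  mu.-integrable setT (EFin \o G) ->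
  is_derive a 1 (fun x => \int[mu]_y f x y)%R (\int[mu]_y df a y)%R.
Proof.
move=> d0 jf Df dfG jG.
have aI : (`]a - d, a + d[%classic : set R) a.
  by rewrite /= in_itv /= ltrBlDr !ltrDl d0.
have d1E x y : (`]a - d, a + d[%classic : set R) x -> partial1of2 f x y = df x y.
  rewrite /= in_itv /= => xI; have D := Df x y xI.
  by rewrite partial1of2E derive_val.
have G0 y : 0 <= G y.
  by apply: le_trans (dfG a y _); rewrite ?normr_ge0 // ltrBlDr !ltrDl d0.
have jf' x : (`]a - d, a + d[%classic : set R) x -> mu.-integrable setT (EFin \o f x).
  by rewrite /= in_itv; exact: jf.
have Df' x y : (`]a - d, a + d[%classic : set R) x -> setT y -> derivable (f ^~ y) x 1.
  by rewrite /= in_itv /= => xI _; case: (Df x y xI).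
have dfG' x y : (`]a - d, a + d[%classic : set R) x -> setT y -> `|partial1of2 f x y| <= G y.
  by move=> xI _; rewrite d1E //; move: xI; rewrite /= in_itv /=; exact: dfG.
apply: DeriveDef.
  exact: (derivable_under_integral measurableT aI jf' Df' G0 jG dfG').
rewrite -derive1E (differentiation_under_integral measurableT aI jf' Df' G0 jG dfG').
by apply: eq_Rintegral => y _; rewrite d1E.
Qed.

End under_integral.

(** For [n = 0] this is, up to the factor [sqrt pi], the solution at time [lam ^ 2 / 4] of
    the heat equation with initial value [h0]. The higher moments are there because the
    family is closed under both partial derivatives. *)
Definition heat {R : realType} (h0 : R -> R) n (th lam : R) : R :=
  (\int[@lebesgue_measure R]_v (gmono n v * h0 (th + lam * v)))%R.

Section smoothing.
Context {R : realType} (h0 : R -> R) (M : R).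
Hypothesis hc : continuous h0.
Hypothesis hM : forall x, `|h0 x| <= M.
Let mu := @lebesgue_measure R.
Local Notation heat := (heat h0).

Let M0 : 0 <= M. Proof. exact: le_trans (normr_ge0 _) (hM 0). Qed.

Lemma continuous_affine (th lam : R) : continuous (fun v : R => th + lam * v).
Proof.
by move=> v; apply: cvgD; [exact: cvg_cst|apply: cvgM => //; exact: cvg_cst].
Qed.

Lemma continuous_kernel n (th lam : R) : continuous (fun v => gmono n v * h0 (th + lam * v)).
Proof.
move=> v; apply: cvgM; first exact: continuous_gmono.
by apply: continuous_comp; [exact: continuous_affine|exact: hc].
Qed.

Lemma integrable_gauss0 (D : R) :
  mu.-integrable setT (EFin \o (fun v : R => D * expR (- (2^-1 * v ^+ 2)))).
Proof.
have h0' : 0 < (2^-1 : R) by rewrite invr_gt0.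
have := integrable_gauss 0 h0'.
move=> /(integrableZl measurableT D).
by congr (mu.-integrable setT _); apply/funext => v /=; rewrite subr0 EFinM.
Qed.

Lemma kernel_bound n : exists2 A, 0 <= A & forall th lam v,
  `|gmono n v * h0 (th + lam * v)| <= A * expR (- (2^-1 * v ^+ 2)).
Proof.
have [A A0 HA] := @gmono_bound R n.
exists (A * M); first by rewrite mulr_ge0 // ltW.
by move=> th lam v; rewrite normrM mulrAC ler_pM.
Qed.

Lemma integrable_kernel n (th lam : R) :
  mu.-integrable setT (EFin \o (fun v => gmono n v * h0 (th + lam * v))).
Proof.
have [A _ HA] := kernel_bound n.
apply: integrable_dominated (HA th lam) (integrable_gauss0 A).
exact: continuous_kernel.
Qed.

Lemma heat_bound n : exists2 B, 0 <= B & forall th lam, `|heat n th lam| <= B.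
Proof.
have [A A0 HA] := kernel_bound n.
exists (\int[mu]_v (A * expR (- (2^-1 * v ^+ 2))))%R.
  by apply: Rintegral_ge0 => v _; rewrite mulr_ge0 // expR_ge0.
move=> th lam; apply: Rintegral_norm_le (HA th lam); first exact: continuous_kernel.
exact: integrable_gauss0.
Qed.

(* Moving the parameters from the rough function [h0] to the Gaussian is what allows
   them to be differentiated. *)
Let conv n (th lam : R) : R := (\int[mu]_p (gmono n ((p - th) / lam) * h0 p))%R.

Lemma continuous_kernel_at n (th lam : R) : continuous (fun p => gmono n ((p - th) / lam) * h0 p).
Proof.
move=> v; apply: cvgM; last exact: hc.
apply: (continuous_comp (f := fun p : R => (p - th) / lam)); last exact: continuous_gmono.
by apply: cvgM; [apply: cvgB => //; exact: cvg_cst|exact: cvg_cst].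
Qed.

(** Locally in the parameters the kernel is dominated by one fixed Gaussian: a shift of
    the centre by at most [1] costs half of the exponent and a constant factor. *)
Lemma kernel_dominated n (th0 L : R) : 0 < L -> exists D, forall th lam p,
  `|th - th0| <= 1 -> 0 < lam <= L ->
  `|gmono n ((p - th) / lam) * h0 p| <= D * expR (- ((4 * L ^+ 2)^-1 * (p - th0) ^+ 2)).
Proof.
move=> L0; have [A A0 HA] := @gmono_bound R n.
exists (A * M * expR ((2 * L ^+ 2)^-1)) => th lam p thth0 /andP[l0 lL].
rewrite normrM (_ : A * M * _ * _ =
  (A * expR ((2 * L ^+ 2)^-1 - (4 * L ^+ 2)^-1 * (p - th0) ^+ 2)) * M); last first.
  by rewrite expRD; ring.
apply: ler_pM => //; apply: (le_trans (HA _)); rewrite ler_pM2l // ler_expR.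
have l2 : lam ^+ 2 <= L ^+ 2 by rewrite ler_sqr ?nnegrE // ltW.
have iL : (L ^+ 2)^-1 <= (lam ^+ 2)^-1 by rewrite lef_pV2 // posrE exprn_gt0.
have iL0 : 0 < (L ^+ 2)^-1 by rewrite invr_gt0 exprn_gt0.
rewrite exprMn exprVn (invfM 2) (invfM 4).
set i := (lam ^+ 2)^-1 in iL *; set j := (L ^+ 2)^-1 in iL iL0 *.
apply: (@le_trans _ _ (- (2^-1 * ((p - th) ^+ 2 * j)))).
  by rewrite lerN2 ler_pM2l ?invr_gt0 // ler_wpM2l ?sqr_ge0.
have t1 : (th - th0) ^+ 2 <= 1 by rewrite -(real_normK (num_real _)) expr_le1.
have sq : (p - th0) ^+ 2 <= 2 * ((p - th) ^+ 2 + 1).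
  have := sqr_ge0 ((p - th) - (th - th0)); nra.
rewrite -subr_ge0 (_ : _ - _ = 4^-1 * j * (2 * ((p - th) ^+ 2 + 1) - (p - th0) ^+ 2)).
  by rewrite mulr_ge0 ?subr_ge0 // mulr_ge0 // ltW.
by field.
Qed.

Lemma integrable_gauss_at (D L c : R) : 0 < L ->
  mu.-integrable setT (EFin \o (fun p : R => D * expR (- ((4 * L ^+ 2)^-1 * (p - c) ^+ 2)))).
Proof.
move=> L0; have b0 : 0 < (4 * L ^+ 2)^-1 by rewrite invr_gt0 mulr_gt0 // exprn_gt0.
have := integrable_gauss c b0.
move=> /(integrableZl measurableT D).
by congr (mu.-integrable setT _); apply/funext => v /=; rewrite EFinM.
Qed.

Lemma integrable_kernel_at n (th lam : R) : 0 < lam ->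
  mu.-integrable setT (EFin \o (fun p => gmono n ((p - th) / lam) * h0 p)).
Proof.
move=> l0; have [D HD] := @kernel_dominated n th lam l0.
apply: integrable_dominated (integrable_gauss_at D th l0).
  exact: continuous_kernel_at.
by move=> p; apply: HD; rewrite ?subrr ?normr0 ?l0 ?lexx.
Qed.

Lemma heat_convolution n (th lam : R) : 0 < lam -> heat n th lam = lam^-1 * conv n th lam.
Proof.
move=> l0; rewrite /conv -(Rintegral_affine th l0); last 2 first.
- exact: continuous_kernel_at.
- exact: integrable_kernel_at.
apply: eq_Rintegral => v _.
by rewrite addrK (mulrC lam) mulfK ?gt_eqF // (addrC th).
Qed.

Lemma conv_linear (c d : R) m k (th lam : R) : 0 < lam ->
  (\int[mu]_p ((c * gmono m ((p - th) / lam) + d * gmono k ((p - th) / lam)) * h0 p))%R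
   = c * conv m th lam + d * conv k th lam.
Proof.
move=> l0; rewrite /conv -RintegralZl //; last exact: integrable_kernel_at.
rewrite -RintegralZl //; last exact: integrable_kernel_at.
have jZ e j : mu.-integrable setT (EFin \o (fun p => e * (gmono j ((p - th) / lam) * h0 p))).
  have := integrable_kernel_at j th l0 => /(integrableZl measurableT e).
  by congr (mu.-integrable setT _); apply/funext => v /=; rewrite EFinM.
rewrite -RintegralD //.
by apply: eq_Rintegral => v _; rewrite mulrDl !mulrA.
Qed.

Lemma is_derive_conv_th n (th lam : R) : 0 < lam -> is_derive th 1 (conv n ^~ lam)
  (lam^-1 * (2 * conv n.+1 th lam - n%:R * conv n.-1 th lam)).
Proof.
move=> l0.
have [D1 HD1] := @kernel_dominated n.+1 th lam l0.
have [D2 HD2] := @kernel_dominated n.-1 th lam l0.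
pose df (x p : R) := (2 / lam * gmono n.+1 ((p - x) / lam)
  + (- (n%:R / lam)) * gmono n.-1 ((p - x) / lam)) * h0 p.
rewrite (_ : lam^-1 * _ = (\int[mu]_p df th p)%R); last by rewrite conv_linear //; ring.
apply: (@is_derive_under_integral _ (fun x p => gmono n ((p - x) / lam) * h0 p) df th 1
  (fun p => (2 / lam * D1 + n%:R / lam * D2) * expR (- ((4 * lam ^+ 2)^-1 * (p - th) ^+ 2)))) => //.
- by move=> x _; exact: integrable_kernel_at.
- move=> x p _; have Dg := is_derive_gmono n ((p - x) / lam).
  apply: is_derive_eq; rewrite /df /GRing.scale /=; ring.
- move=> x p xth; have x1 : `|x - th| <= 1 by rewrite ler_norml; lra.
  have -> : df x p = 2 / lam * (gmono n.+1 ((p - x) / lam) * h0 p) +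
      - (n%:R / lam) * (gmono n.-1 ((p - x) / lam) * h0 p) by rewrite /df; ring.
  rewrite [leRHS]mulrDl -!(mulrA _ _ (expR _)) (le_trans (ler_normD _ _)) //.
  apply: lerD; rewrite normrM ler_pM //.
  + by rewrite ger0_norm // divr_ge0 // ltW.
  + by apply: HD1; rewrite ?l0 ?lexx.
  + by rewrite normrN ger0_norm // divr_ge0 // ltW.
  + by apply: HD2; rewrite ?l0 ?lexx.
- exact: integrable_gauss_at.
Qed.

Lemma is_derive_conv_lam n (th lam : R) : 0 < lam -> is_derive lam 1 (conv n th)
  (lam^-1 * (2 * conv n.+2 th lam - n%:R * conv n th lam)).
Proof.
move=> l0; pose L := 2 * lam; have L0 : 0 < L by rewrite mulr_gt0.
have [D1 HD1] := @kernel_dominated n.+2 th L L0.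
have [D2 HD2] := @kernel_dominated n th L L0.
pose df (x p : R) := (2 / x * gmono n.+2 ((p - th) / x)
  + (- (n%:R / x)) * gmono n ((p - th) / x)) * h0 p.
rewrite (_ : lam^-1 * _ = (\int[mu]_p df lam p)%R); last by rewrite conv_linear //; ring.
have l20 : 0 < lam / 2 by rewrite divr_gt0.
apply: (@is_derive_under_integral _ (fun x p => gmono n ((p - th) / x) * h0 p) df lam (lam / 2)
  (fun p => (2 / (lam / 2) * D1 + n%:R / (lam / 2) * D2) * expR (- ((4 * L ^+ 2)^-1 * (p - th) ^+ 2)))) => //.
- by move=> x xl; apply: integrable_kernel_at; lra.
- move=> x p xl; have x0 : 0 < x by lra.
  have Dg := is_derive_gmono n ((p - th) / x).
  have xn : x != 0 by rewrite gt_eqF.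
  have Di := is_derive_inv xn.
  apply: is_derive_eq; rewrite /df /GRing.scale /= /gmono; case: n {Dg HD1 HD2 df} => [|n] /=.
    by rewrite mul0r; field.
  by rewrite !exprS; field.
- move=> x p xl; have x0 : 0 < x by lra.
  have xL : 0 < x <= L by rewrite x0 /=; rewrite /L; lra.
  have ix : x^-1 <= (lam / 2)^-1 by rewrite lef_pV2 ?posrE //; lra.
  have ix0 : 0 < x^-1 by rewrite invr_gt0.
  have x1 : `|th - th| <= 1 by rewrite subrr normr0.
  have -> : df x p = 2 / x * (gmono n.+2 ((p - th) / x) * h0 p) +
      - (n%:R / x) * (gmono n ((p - th) / x) * h0 p) by rewrite /df; ring.
  rewrite [leRHS]mulrDl -!(mulrA _ _ (expR _)) (le_trans (ler_normD _ _)) //.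
  apply: lerD; rewrite normrM ler_pM //.
  + by rewrite ger0_norm ?ler_pM2l // divr_ge0 // ltW.
  + exact: HD1.
  + by rewrite normrN ger0_norm ?ler_wpM2l // divr_ge0 // ltW.
  + exact: HD2.
- exact: integrable_gauss_at.
Qed.

(** Together with [is_derive_heat_lam] this is the heat equation: for [n = 0] the second
    derivative in [th] and [2 / lam] times the derivative in [lam] are both equal to
    [2 / lam ^ 2 * (2 * heat 2 - heat 0)]. *)
Lemma is_derive_heat_th n (th lam : R) : 0 < lam -> is_derive th 1 (heat n ^~ lam)
  (lam^-1 * (2 * heat n.+1 th lam - n%:R * heat n.-1 th lam)).
Proof.
move=> l0; have D := is_derive_conv_th n th l0.
rewrite (_ : heat n ^~ lam = fun th => lam^-1 * conv n th lam); last first.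
  by apply/funext => x; exact: heat_convolution.
apply: is_derive_eq; rewrite /GRing.scale /= !heat_convolution //; ring.
Qed.

Lemma is_derive_heat_lam n (th lam : R) : 0 < lam -> is_derive lam 1 (heat n th)
  (lam^-1 * (2 * heat n.+2 th lam - n.+1%:R * heat n th lam)).
Proof.
move=> l0; have D := is_derive_conv_lam n th l0.
have ln : lam != 0 by rewrite gt_eqF.
have Di := is_derive_inv ln.
have D' : is_derive lam 1 (fun x => x^-1 * conv n th x)
   (lam^-1 * (2 * heat n.+2 th lam - n.+1%:R * heat n th lam)).
  by apply: is_derive_eq; rewrite /GRing.scale /= !heat_convolution // -natr1; field.
apply: near_eq_is_derive D'.
by near=> x; apply/esym/heat_convolution; near: x; exact: lt_nbhsr.
Unshelve. all: by end_near. Qed.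

End smoothing.

(** * Lower bound for the radius of curvature *)

Section antiderivative.
Context {R : realType}.
Let mu := @lebesgue_measure R.

Lemma antiderivative (f : R -> R) : continuous f ->
  exists F : R -> R, forall x : R, is_derive x 1 F (f x).
Proof.
move=> cf.
have jf (a b : R) : mu.-integrable `[a, b] (EFin \o f).
  apply: continuous_compact_integrable; first exact: segment_compact.
  exact: continuous_subspaceT.
exists (fun x => if 0 <= x then (\int[mu]_(t in `]0%R, x]) f t)%R
  else - (\int[mu]_(t in `]x, 0%R]) f t)%R) => x.
pose N := `|x| + 1; pose G y := (\int[mu]_(t in `[- N, y]) f t)%R.
have xN : x < N by rewrite /N ltr_pwDr // ler_norm.
have Nx : - N < x by rewrite ltrNl /N ltr_pwDr // -normrN ler_norm.
have N0 : - N <= 0 by rewrite oppr_le0 /N addr_ge0.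
have [dG G'] := continuous_FTC1_closed xN (jf (- N) N) Nx (cf x).
have DG : is_derive x 1 G (f x) by apply: (DeriveDef dG); rewrite -derive1E; exact: G'.
have DG0 : is_derive x 1 (fun y => G y - G 0) (f x).
  by apply: is_derive_eq; rewrite subr0.
apply: near_eq_is_derive DG0; near=> y.
have Ny : - N < y by near: y; exact: lt_nbhsr.
case: ifPn => [y0|]; last rewrite -ltNge => y0.
- rewrite /G (@Rintegral_itvB _ _ (BLeft (- N)) (BRight y)) ?bnd_simp //.
- rewrite -opprB /G (@Rintegral_itvB _ _ (BLeft (- N)) (BRight 0)) ?bnd_simp //; exact: ltW.
Unshelve. all: by end_near. Qed.

Lemma FTC2 (f F : R -> R) (a b : R) : a < b -> continuous f ->
  (forall x : R, is_derive x 1 F (f x)) -> (\int[mu]_(x in `[a, b]) f x)%R = F b - F a.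
Proof.
move=> ab cf DF; rewrite /Rintegral (@continuous_FTC2 _ f F a b ab (continuous_subspaceT cf)) //.
- have cF x : {for x, continuous F} by exact: is_derive_continuous (DF x).
  split => [x _||]; first by case: (DF x).
  + exact/cvg_at_right_filter/cF.
  + exact/cvg_at_left_filter/cF.
- by move=> x _; rewrite derive1E derive_val.
Qed.

Lemma Rintegral_le_setT (f : R -> R) (A : set (measurableTypeR R)) : measurable A ->
  mu.-integrable setT (EFin \o f) -> (forall x, 0 <= f x) ->
  (\int[mu]_(x in A) f x)%R <= (\int[mu]_x f x)%R.
Proof.
move=> mA jf f0; have jA := integrableS measurableT mA (@subsetT _ _) jf.
apply: fine_le; [exact: integrable_fin_num|exact: integrable_fin_num|].
by apply: ge0_subset_integral => //; [case/integrableP: jf|move=> x _; rewrite lee_fin].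
Qed.

(** The second derivative test, for a function whose second derivative is known to exist
    only at the minimum. *)
Lemma second_derivative_min (f df : R -> R) (l : R) :
  (forall a : R, is_derive a 1 f (df a)) -> is_derive (0 : R) 1 df l ->
  f 0 = 0 -> df 0 = 0 -> (forall a, 0 <= f a) -> 0 <= l.
Proof.
move=> Df /is_derive1_caratheodory[g [gE gc g0]] f0 df0 fge0.
rewrite leNgt; apply/negP => l0.
have : \forall x \near (0 : R), g x < 0.
  have gc' : g x @[x --> (0 : R)] --> l by rewrite -g0; exact: gc.
  exact: (cvgr_lt _ gc' _ l0).
move=> /nbhs_ballP[e /= e0 He].
have e20 : 0 < e / 2 by rewrite divr_gt0.
have [c /andP[c0 ce]] := mvt e20 (fun x _ => Df x).
have : g c < 0.
  apply: He; rewrite /ball /= sub0r normrN gtr0_norm //.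
  by apply: lt_trans ce _; rewrite gtr_pMr // invf_lt1 ?ltr1n.
move=> gc0; have := gE c; rewrite df0 !subr0 f0 subr0 => -> fE.
have := fge0 (e / 2); rewrite fE leNgt => /negP; apply.
by rewrite nmulr_rlt0 // nmulr_rlt0.
Qed.

End antiderivative.

(** By the heat equation this is [w + w''] for [w = heat h0 0], hence the radius of
    curvature of the evolved curve up to a factor that depends on [lam] alone. *)
Definition rho {R : realType} (h0 : R -> R) (th lam : R) : R :=
  heat h0 0 th lam + 2 / lam ^+ 2 * (2 * heat h0 2 th lam - heat h0 0 th lam).

Section positivity.
Context {R : realType} (h0 : R -> R) (M : R).
Hypothesis hc : continuous h0.
Hypothesis hM : forall x, `|h0 x| <= M.
Let mu := @lebesgue_measure R.
Local Notation heat := (heat h0).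

Variables (F : R -> R) (P : R).
Hypothesis DF : forall x : R, is_derive x 1 F (h0 x).
Hypothesis FP : forall x, F (x + pi *+ 2) - F x = P.
(* A form of the inequality [h0 + h0'' >= 0] that makes sense without derivatives. *)
Hypothesis htrig : forall th a, 2 * cos a * h0 th <= h0 (th + a) + h0 (th - a).

(** The convolution of the nonnegative function
    [h0 (p + a) + h0 (p - a) - 2 * cos a * h0 p] is at least the part of it over one
    period, where the Gaussian is bounded below. The integral of that function over a
    period is [2 * P * (1 - cos a)], which is positive even where the function itself
    vanishes. *)
Lemma heat0_trig (th a lam : R) : 0 < lam ->
  2 * (P / lam * expR (- (pi / lam) ^+ 2)) * (1 - cos a) <=
  heat 0 (th + a) lam + heat 0 (th - a) lam - 2 * cos a * heat 0 th lam.
Proof.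
move=> l0.
pose D p := h0 (p + a) + h0 (p - a) - 2 * cos a * h0 p.
have D0 p : 0 <= D p by rewrite subr_ge0.
have cD : continuous D.
  move=> p; apply: cvgB; first apply: cvgD.
  - by apply: (continuous_comp (f := fun p => p + a)); [apply: cvgD => //; exact: cvg_cst|exact: hc].
  - by apply: (continuous_comp (f := fun p => p - a)); [apply: cvgB => //; exact: cvg_cst|exact: hc].
  - by apply: cvgM; [exact: cvg_cst|exact: hc].
have jk := integrable_kernel hc hM 0.
have -> : heat 0 (th + a) lam + heat 0 (th - a) lam - 2 * cos a * heat 0 th lam =
    (\int[mu]_v (gmono 0 v * D (th + lam * v)))%R.
  have jZ : mu.-integrable setT (EFin \o (fun v => 2 * cos a * (gmono 0 v * h0 (th + lam * v)))).
    have := jk th lam => /(integrableZl measurableT (2 * cos a)).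
    by congr (mu.-integrable setT _); apply/funext => v /=; rewrite EFinM.
  have jD : mu.-integrable setT (EFin \o (fun v => gmono 0 v * h0 (th + a + lam * v) + gmono 0 v * h0 (th - a + lam * v))).
    have := integrableD measurableT (jk (th + a) lam) (jk (th - a) lam).
    by congr (mu.-integrable setT _); apply/funext => v /=; rewrite EFinD.
  rewrite /heat -RintegralD // -RintegralZl // -RintegralB //.
  apply: eq_Rintegral => v _; rewrite /D.
  rewrite (addrAC th (lam * v) a) (addrAC th (lam * v) (- a)); ring.
have cDl : continuous (fun v => D (th + lam * v)).
  by move=> v; apply: (continuous_comp (f := fun v => th + lam * v)); [exact: continuous_affine|exact: cD].
have cint : continuous (fun v => gmono 0 v * D (th + lam * v)).
  by move=> v; apply: cvgM; [exact: continuous_gmono|exact: cDl].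
set E := expR _.
(* The values of [v] for which [th + lam * v] runs over one period. *)
set I := (`[- (pi / lam), pi / lam])%classic.
have g0 v : 0 <= gmono 0 v * D (th + lam * v) by rewrite mulr_ge0 // /gmono expr0 mul1r expR_ge0.
have pl0 : 0 < pi / lam by rewrite divr_gt0 // pi_gt0.
have jI (f : R -> R) : continuous f -> mu.-integrable I (EFin \o f).
  move=> cf; apply: continuous_compact_integrable; first exact: segment_compact.
  exact: continuous_subspaceT.
apply: (@le_trans _ _ (\int[mu]_(v in I) (gmono 0 v * D (th + lam * v)))%R); last first.
  apply: Rintegral_le_setT g0; first exact: measurable_itv.
  have hD p : `|D p| <= 4 * M.
    have h1 := hM p; have h2 := hM (p + a); have h3 := hM (p - a).
    rewrite /D (le_trans (ler_normB _ _)) // normrM normrM (ger0_norm (ler0n _ 2)).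
    have := ler_normD (h0 (p + a)) (h0 (p - a)); have : `|cos a| * `|h0 p| <= 1 * M by apply: ler_pM => //; exact: cos_max.
    rewrite -mulrA; lra.
  exact: (integrable_kernel cD hD).
apply: (@le_trans _ _ (\int[mu]_(v in I) (E * D (th + lam * v)))%R); last first.
  apply: le_Rintegral.
  - exact: measurable_itv.
  - by apply: jI => v; apply: cvgM; [exact: cvg_cst|exact: cDl].
  - exact: jI.
  move=> v; rewrite /I /= in_itv /= => vI; rewrite ler_wpM2r // /gmono expr0 mul1r /E ler_expR lerN2.
  have vl : `|v| <= pi / lam by rewrite ler_norml.
  rewrite -(real_normK (num_real v)); apply: lerXn2r vl; rewrite nnegrE //; exact: ltW.
rewrite RintegralZl; [|exact: measurable_itv|exact: jI].
pose FD p := F (p + a) + F (p - a) - 2 * cos a * F p.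
have ln : lam != 0 by rewrite gt_eqF.
have DFD (v : R) : is_derive v 1 (fun v => lam^-1 * FD (th + lam * v)) (D (th + lam * v)).
  rewrite /FD; have D1 := DF (th + lam * v + a); have D2 := DF (th + lam * v - a).
  have D3 := DF (th + lam * v).
  by apply: is_derive_eq; rewrite /GRing.scale /= /D; field.
have ab : - (pi / lam) < pi / lam by rewrite -subr_gt0 opprK addr_gt0.
rewrite (FTC2 ab cDl DFD).
rewrite mulrN (_ : lam * (pi / lam) = pi); last by field.
have FPa x : F (x + pi) = F (x - pi) + P.
  by rewrite -(FP (x - pi)) (addrC (F _)) subrK; congr F; ring.
have -> : FD (th + pi) = FD (th - pi) + 2 * P * (1 - cos a).
  rewrite /FD (addrAC _ pi a) (addrAC _ pi (- a)) !FPa.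
  rewrite (addrAC _ (- pi) a) (addrAC _ (- pi) (- a)); ring.
rewrite le_eqVlt; apply/orP; left; apply/eqP.
by field.
Qed.

(** Dividing [heat0_trig] by [a ^ 2] and letting [a] tend to [0] yields [w + w''] on one
    side and the constant on the other; the limit is taken as a second derivative test at
    [a = 0]. *)
Lemma rho_lower_bound (th lam : R) : 0 < lam ->
  P / lam * expR (- (pi / lam) ^+ 2) <= rho h0 th lam.
Proof.
move=> l0; set c := _ * expR _.
have ln : lam != 0 by rewrite gt_eqF.
pose w t := heat 0 t lam.
pose k1 t := lam^-1 * (2 * heat 1 t lam).
pose k2 t := lam^-1 * (2 * (lam^-1 * (2 * heat 2 t lam - w t))).
have D0 (t : R) : is_derive t 1 w (k1 t).
  have := is_derive_heat_th hc hM 0 t l0.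
  by rewrite mul0r subr0.
have D1 (t : R) : is_derive t 1 k1 (k2 t).
  have D := is_derive_heat_th hc hM 1 t l0; rewrite /k1.
  by apply: is_derive_eq; rewrite /GRing.scale /= /k2 /w; ring.
(* [f] is nonnegative, vanishes at [0], and [f'' 0 = 2 * (rho h0 th lam - c)]. *)
pose f a := w (th + a) + w (th - a) - 2 * cos a * w th - 2 * c * (1 - cos a).
pose df a := k1 (th + a) - k1 (th - a) + 2 * sin a * w th - 2 * c * sin a.
have : 0 <= 2 * (rho h0 th lam - c).
  apply: (@second_derivative_min _ f df (2 * (rho h0 th lam - c))).
  - move=> a; have D2 := D0 (th + a); have D3 := D0 (th - a).
    rewrite /f; apply: is_derive_eq; rewrite /GRing.scale /= /df; ring.
  - have D2 : is_derive (th + 0) 1 k1 (k2 th) by rewrite addr0.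
    have D3 : is_derive (th - 0) 1 k1 (k2 th) by rewrite subr0.
    rewrite /df; apply: is_derive_eq; rewrite /GRing.scale /= cos0 /rho /k2 /w; field.
    by [].
  - by rewrite /f addr0 subr0 cos0; ring.
  - by rewrite /df addr0 subr0 sin0; ring.
  - by move=> a; rewrite /f subr_ge0 heat0_trig.
by rewrite pmulr_rge0 // subr_ge0.
Qed.

Lemma heat0_at0 th : heat 0 th 0 = Num.sqrt pi * h0 th.
Proof.
rewrite /heat.
under eq_Rintegral => v _ do rewrite mul0r addr0.
rewrite RintegralZr //; last first.
  have := @integrableT_gauss R; congr (mu.-integrable setT _).
  by apply/funext => v; rewrite /= /gmono expr0 mul1r.
congr (_ * _); rewrite /Rintegral.
under eq_integral do rewrite /gmono expr0 mul1r.
by rewrite -[X in fine X]/(\int[mu]_x (gauss_fun x)%:E)%E integralT_gauss.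
Qed.

Lemma heat0_continuous_at0 th : {for 0, continuous (heat 0 th)}.
Proof.
have [A A0 HA] := kernel_bound hM 0.
have Z : (0 : R) \in (`]-1, 1[%classic : set R) by rewrite inE /= in_itv /= ltrN10 ltr01.
apply: (@continuity_under_integral _ _ _ mu (fun l v => gmono 0 v * h0 (th + l * v)) setT
  measurableT (-1) 1 _ _ (fun v => A * expR (- (2^-1 * v ^+ 2)))) => //.
- by move=> x _; exact: integrable_kernel.
- apply: aeW => v _ x _; apply: cvgM; first exact: cvg_cst.
  apply: continuous_comp; last exact: hc.
  by apply: cvgD; [exact: cvg_cst|apply: cvgM => //; exact: cvg_cst].
- exact: integrable_gauss0.
- by move=> x _; apply: aeW => v _; exact: HA.
Qed.

End positivity.

(** * Functions of an angle and a positive scale *)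

Section two_variables.
Context {R : realType}.
Implicit Types (g gth glam : R -> R -> R).

Definition jcont g := forall th lam : R, 0 < lam ->
  (fun z : R * R => g z.1 z.2) z @[z --> (th, lam)] --> g th lam.

Definition partials g gth glam := forall th lam : R, 0 < lam ->
  is_derive th 1 (g ^~ lam) (gth th lam) /\ is_derive lam 1 (g th) (glam th lam).

(** Differentiability in the only form that is used: along curves. It follows from the
    existence of partial derivatives if these are continuous ([chain_partials]); as sums,
    products and inverses inherit it directly, that continuity only has to be checked for
    the moments. *)
Definition chain g gth glam := forall (f m : R -> R) (t a b : R), 0 < m t ->
  is_derive t 1 f a -> is_derive t 1 m b ->
  is_derive t 1 (fun e => g (f e) (m e)) (gth (f t) (m t) * a + glam (f t) (m t) * b).

Lemma jcont_cvg g (T : Type) (F : set_system T) (FF : Filter F) (f1 f2 : T -> R) (th lam : R) :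
  jcont g -> 0 < lam -> f1 x @[x --> F] --> th -> f2 x @[x --> F] --> lam ->
  g (f1 x) (f2 x) @[x --> F] --> g th lam.
Proof.
move=> cg l0 c1 c2.
have c : (f1 x, f2 x) @[x --> F] --> (th, lam).
  exact: (@cvg_pair _ _ _ F (nbhs th) (nbhs lam) FF _ _ f1 f2 c1 c2).
exact: (@cvg_comp _ _ _ (fun x => (f1 x, f2 x)) (fun z => g z.1 z.2) _ _ _ c (cg th lam l0)).
Qed.

(** The difference is split along a horizontal and a vertical segment. The bound from
    below on [eta] keeps the vertical one in the region of positive scales. *)
Lemma slope2 g gth glam : partials g gth glam ->
  forall th lam ph mu, 0 < lam -> 0 < mu -> exists xi eta,
  [/\ `|xi - th| <= `|ph - th|, `|eta - lam| <= `|mu - lam|, Num.min lam mu <= eta &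
      g ph mu - g th lam = gth xi mu * (ph - th) + glam th eta * (mu - lam)].
Proof.
move=> Dg th lam ph mu l0 m0.
have [|xi xiE [_ E1]] := @mvt_between _ (g ^~ mu) (gth ^~ mu) th ph.
  by move=> x _; case: (Dg x mu m0).
have [|eta etaE [meta E2]] := @mvt_between _ (g th) (glam th) lam mu.
  move=> x mx; have x0 : 0 < x by apply: lt_le_trans mx; rewrite lt_min l0.
  by case: (Dg th x x0).
exists xi, eta; split=> //.
by rewrite -E1 -E2 /= addrA subrK.
Qed.

Lemma cvg_between (T : Type) (F : set_system T) (FF : Filter F) (u v : T -> R) l :
  (\forall x \near F, `|u x - l| <= `|v x - l|) -> v x @[x --> F] --> l -> u x @[x --> F] --> l.
Proof.
move=> uv /cvgrPdist_lt cv; apply/cvgrPdist_lt => e e0.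
move: (cv e e0); apply: filterS2 uv => x uv ve; rewrite distrC.
by apply: le_lt_trans uv _; rewrite distrC.
Qed.

Lemma jcont_bounded_partials g gth glam : partials g gth glam ->
  (forall a : R, 0 < a -> exists K : R, forall th lam, a <= lam -> `|gth th lam| <= K /\ `|glam th lam| <= K) ->
  jcont g.
Proof.
move=> Dg Hb th lam l0.
have l20 : 0 < lam / 2 by rewrite divr_gt0.
have [K HK] := Hb (lam / 2) l20.
have K0 : 0 <= K by apply: le_trans (normr_ge0 _) (HK th (lam / 2) (lexx _)).1.
apply/cvgrPdist_lt => e e0.
have d0 : 0 < e / (2 * K + 1) by rewrite divr_gt0 // ltr_wpDl // mulr_ge0.
have nearth : \forall z \near (th, lam), `|z.1 - th| < e / (2 * K + 1).
  have /cvgrPdist_lt/(_ _ d0) : z.1 @[z --> (th, lam)] --> th by exact: cvg_fst.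
  by apply: filterS => z; rewrite distrC.
have nearlam d : 0 < d -> \forall z \near (th, lam), `|z.2 - lam| < d.
  have c2 : z.2 @[z --> (th, lam)] --> lam by exact: cvg_snd.
  by move=> dd0; move/cvgrPdist_lt: c2 => /(_ _ dd0); apply: filterS => z; rewrite distrC.
near=> z.
have z1 : `|z.1 - th| < e / (2 * K + 1) by near: z.
have z2 : `|z.2 - lam| < e / (2 * K + 1) by near: z; exact: nearlam.
have z3 : `|z.2 - lam| < lam / 2 by near: z; apply: nearlam; rewrite divr_gt0.
have lz : lam / 2 <= z.2 by move: z3; rewrite ltr_norml; lra.
have z0 : 0 < z.2 by apply: lt_le_trans lz; rewrite divr_gt0.
have [xi [eta [_ _ meta E]]] := slope2 Dg th z.1 l0 z0.
have le : lam / 2 <= eta.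
  by apply: le_trans meta; rewrite le_min lz andbT ler_pdivrMr //; lra.
rewrite distrC E (le_lt_trans (ler_normD _ _)) // !normrM.
have [k1 _] := HK xi z.2 lz; have [_ k2] := HK th eta le.
apply: (@le_lt_trans _ _ (K * (e / (2 * K + 1)) + K * (e / (2 * K + 1)))).
  by apply: lerD; apply: ler_pM => //; exact: ltW.
rewrite -mulrDl (_ : (K + K) * _ = e * ((2 * K) / (2 * K + 1))); last by ring.
rewrite gtr_pMr // ltr_pdivrMr ?mul1r ?ltrDl //.
by rewrite ltr_wpDl // mulr_ge0.
Unshelve. all: by end_near. Qed.

Lemma chain_partials g gth glam : partials g gth glam -> jcont gth -> jcont glam ->
  chain g gth glam.
Proof.
move=> Dg cth clam f m t a b mt0 Df Dm.
have cf : f x @[x --> t] --> f t by exact: (is_derive_continuous Df).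
have cm : m x @[x --> t] --> m t by exact: (is_derive_continuous Dm).
move: Df Dm => /is_derive1_caratheodory[A [fE cA At]] /is_derive1_caratheodory[B [mE cB Bt]].
have ex (e : R) : exists p : R * R, 0 < m e ->
  [/\ `|p.1 - f t| <= `|f e - f t|, `|p.2 - m t| <= `|m e - m t| &
   g (f e) (m e) - g (f t) (m t) = (gth p.1 (m e) * A e + glam (f t) p.2 * B e) * (e - t)].
  have [me0|] := ltP 0 (m e); last by exists (0, 0).
  have [xi [eta [h1 h2 _ E]]] := slope2 Dg (f t) (f e) mt0 me0.
  by exists (xi, eta); split => //=; rewrite E fE mE; ring.
have [p Hp] := choice ex.
(* A slope function of the composite curve; where the scale is not positive it is the
   plain difference quotient, which does no harm because [m] is positive near [t]. *)
pose S e := if 0 < m e then gth (p e).1 (m e) * A e + glam (f t) (p e).2 * B e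
  else (g (f e) (m e) - g (f t) (m t)) / (e - t).
apply/is_derive1_caratheodory; exists S; split.
- move=> e; rewrite /S; case: ifPn => [me0|me0]; first by have [_ _ ->] := Hp e me0.
  rewrite divfK // subr_eq0; apply: contraNneq me0 => ->; exact: mt0.
- have nearm : \forall e \near t, 0 < m e by apply: (cvgr_gt _ cm).
  have c1 : (p e).1 @[e --> t] --> f t.
    by apply: cvg_between cf; apply: filterS nearm => e me; have [] := Hp e me.
  have c2 : (p e).2 @[e --> t] --> m t.
    by apply: cvg_between cm; apply: filterS nearm => e me; have [] := Hp e me.
  have key : gth (p e).1 (m e) * A e + glam (f t) (p e).2 * B e @[e --> t] -->
      gth (f t) (m t) * A t + glam (f t) (m t) * B t.
    apply: cvgD; apply: cvgM => //.
      exact: jcont_cvg.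
    by apply: jcont_cvg => //; exact: cvg_cst.
  have StE : S t = gth (f t) (m t) * A t + glam (f t) (m t) * B t.
    rewrite /S mt0; have [] := Hp t mt0.
    rewrite !subrr !normr0 !normr_le0 !subr_eq0 => /eqP -> /eqP -> _; by [].
  change (S e @[e --> t] --> S t); rewrite StE.
  apply: cvg_trans key; apply: near_eq_cvg; apply: filterS nearm => e me.
  by rewrite /S me.
- rewrite /S mt0; have [] := Hp t mt0.
  by rewrite !subrr !normr0 !normr_le0 !subr_eq0 At Bt => /eqP -> /eqP -> _.
Qed.

Lemma chain_add g1 g1t g1l g2 g2t g2l : chain g1 g1t g1l -> chain g2 g2t g2l ->
  chain (fun th lam => g1 th lam + g2 th lam) (fun th lam => g1t th lam + g2t th lam)
    (fun th lam => g1l th lam + g2l th lam).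
Proof.
move=> c1 c2 f m t a b m0 Df Dm; have D1 := c1 _ _ _ _ _ m0 Df Dm.
have D2 := c2 _ _ _ _ _ m0 Df Dm.
apply: is_derive_eq; ring.
Qed.

Lemma chain_mul g1 g1t g1l g2 g2t g2l : chain g1 g1t g1l -> chain g2 g2t g2l ->
  chain (fun th lam => g1 th lam * g2 th lam)
    (fun th lam => g1t th lam * g2 th lam + g1 th lam * g2t th lam)
    (fun th lam => g1l th lam * g2 th lam + g1 th lam * g2l th lam).
Proof.
move=> c1 c2 f m t a b m0 Df Dm; have D1 := c1 _ _ _ _ _ m0 Df Dm.
have D2 := c2 _ _ _ _ _ m0 Df Dm.
by apply: is_derive_eq; rewrite /GRing.scale /=; ring.
Qed.

Lemma chain_inv g gt gl : (forall th lam, 0 < lam -> g th lam != 0) -> chain g gt gl ->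
  chain (fun th lam => (g th lam)^-1)
    (fun th lam => -1 * ((g th lam)^-1 * (g th lam)^-1) * gt th lam)
    (fun th lam => -1 * ((g th lam)^-1 * (g th lam)^-1) * gl th lam).
Proof.
move=> g0 c f m t a b m0 Df Dm; have D1 := c _ _ _ _ _ m0 Df Dm.
have Di := is_derive_inv (g0 (f t) _ m0).
by apply: is_derive_eq; rewrite expr2 invfM; ring.
Qed.

Lemma chain_angle (u du : R -> R) : (forall x : R, is_derive x 1 u (du x)) ->
  chain (fun th _ => u th) (fun th _ => du th) (fun _ _ => 0).
Proof.
move=> Du f m t a b m0 Df Dm; have D1 := Du (f t).
by apply: is_derive_eq; ring.
Qed.

Lemma chain_scale (u du : R -> R) : (forall x : R, 0 < x -> is_derive x 1 u (du x)) ->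
  chain (fun _ lam => u lam) (fun _ _ => 0) (fun _ lam => du lam).
Proof.
move=> Du f m t a b m0 Df Dm; have D1 := Du (m t) m0.
by apply: is_derive_eq; ring.
Qed.

Lemma jcont_angle (u : R -> R) : continuous u -> jcont (fun th _ => u th).
Proof.
move=> cu th lam l0; have c : z.1 @[z --> (th, lam)] --> th by exact: cvg_fst.
exact: (@cvg_comp _ _ _ _ u _ _ _ c (cu th)).
Qed.

Lemma jcont_scale (u : R -> R) : (forall x : R, 0 < x -> {for x, continuous u}) ->
  jcont (fun _ lam => u lam).
Proof.
move=> cu th lam l0; have c : z.2 @[z --> (th, lam)] --> lam by exact: cvg_snd.
exact: (@cvg_comp _ _ _ _ u _ _ _ c (cu lam l0)).
Qed.

Lemma is_derive_chain_scale g gt gl : chain g gt gl -> forall th lam : R, 0 < lam ->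
  is_derive lam 1 (g th) (gl th lam).
Proof.
move=> c th lam l0.
have := c (cst th) id lam 0 1 l0 (is_derive_cst _ _ _) (is_derive_id _ _).
by rewrite mulr1 mulr0 add0r.
Qed.

End two_variables.

(** * Tame functions *)

(** All derivatives of the potential are such functions of the normal angle and the
    scale. The class is spelled out by its generators so that closure under partial
    derivatives, periodicity and growth can each be checked by induction. *)
Inductive tame {R : realType} (h0 : R -> R) : (R -> R -> R) -> Prop :=
| tame_cst c : tame h0 (fun _ _ => c)
| tame_cos : tame h0 (fun th _ => cos th)
| tame_sin : tame h0 (fun th _ => sin th)
| tame_scale : tame h0 (fun _ lam => lam)
| tame_scaleV : tame h0 (fun _ lam => lam^-1)
| tame_exp : tame h0 (fun _ lam => expR (4^-1 * (lam * lam)))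
| tame_expN : tame h0 (fun _ lam => expR (- (4^-1 * (lam * lam))))
| tame_flat : tame h0 (fun _ lam => expR (- lam^-1 ^+ 4))
| tame_heat n : tame h0 (fun th lam => heat h0 n th lam)
| tame_rhoV : tame h0 (fun th lam => (rho h0 th lam)^-1)
| tame_add g1 g2 : tame h0 g1 -> tame h0 g2 -> tame h0 (fun th lam => g1 th lam + g2 th lam)
| tame_mul g1 g2 : tame h0 g1 -> tame h0 g2 -> tame h0 (fun th lam => g1 th lam * g2 th lam).

Section tame_functions.
Context {R : realType} (h0 : R -> R) (M P : R).
Hypothesis hc : continuous h0.
Hypothesis hM : forall x, `|h0 x| <= M.
Hypothesis hper : forall x, h0 (x + pi *+ 2) = h0 x.
Hypothesis P0 : 0 < P.
Hypothesis hrho : forall th lam : R, 0 < lam ->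
  P / lam * expR (- (pi / lam) ^+ 2) <= rho h0 th lam.
Local Notation heat := (heat h0).
Local Notation rho := (rho h0).
Local Notation tame := (tame h0).

Lemma rho_gt0 th lam : 0 < lam -> 0 < rho th lam.
Proof.
by move=> l0; apply: lt_le_trans (hrho th l0); rewrite mulr_gt0 ?expR_gt0 // divr_gt0.
Qed.

Let heat_th n th lam := lam^-1 * (2 * heat n.+1 th lam + - n%:R * heat n.-1 th lam).
Let heat_lam n th lam := lam^-1 * (2 * heat n.+2 th lam + - n.+1%:R * heat n th lam).

Lemma partials_heat n : partials (heat n) (heat_th n) (heat_lam n).
Proof.
move=> th lam l0; split; rewrite /heat_th /heat_lam mulNr.
- exact: is_derive_heat_th.
- exact: is_derive_heat_lam.
Qed.

(** Each moment has partial derivatives that are bounded for scales away from [0], being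
    combinations of bounded moments. *)
Lemma jcont_heat n : jcont (heat n).
Proof.
apply: (jcont_bounded_partials (partials_heat n)) => a a0.
have [B0 B00 H0] := heat_bound hc hM n; have [B1 B10 H1] := heat_bound hc hM n.+1.
have [B2 B20 H2] := heat_bound hc hM n.+2; have [B3 B30 H3] := heat_bound hc hM n.-1.
have n1 : `|(2 : R)| = 2 by rewrite normr_nat.
have K1 : 0 <= 2 * B1 + n%:R * B3 by rewrite addr_ge0 // mulr_ge0.
have K2 : 0 <= 2 * B2 + n.+1%:R * B0 by rewrite addr_ge0 // mulr_ge0.
exists (a^-1 * (2 * B1 + n%:R * B3) + a^-1 * (2 * B2 + n.+1%:R * B0)) => th lam al.
have l0 : 0 < lam := lt_le_trans a0 al.
have il : `|lam^-1| <= a^-1 by rewrite gtr0_norm ?invr_gt0 // lef_pV2.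
have b (c k x y B B' : R) : 0 <= c -> `|x| <= B -> `|y| <= B' -> `|2 * x + - c * y| <= 2 * B + c * B'.
  move=> c0 xB yB; rewrite (le_trans (ler_normD _ _)) // mulNr normrN !normrM n1 (ger0_norm c0).
  by rewrite lerD // ler_wpM2l.
split; rewrite /heat_th /heat_lam normrM.
- rewrite -[leLHS]addr0 lerD //; first by rewrite ler_pM // b.
  by rewrite mulr_ge0 // invr_ge0 ltW.
- rewrite -[leLHS]add0r lerD //; last by rewrite ler_pM // b.
  by rewrite mulr_ge0 // invr_ge0 ltW.
Qed.

Lemma jcont_cst_mul (c : R) (g : R -> R -> R) : jcont g -> jcont (fun th lam => c * g th lam).
Proof. by move=> cg th lam l0; apply: cvgM; [exact: cvg_cst|exact: cg]. Qed.

Lemma chain_heat n : chain (heat n) (heat_th n) (heat_lam n).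
Proof.
apply: chain_partials; first exact: partials_heat.
- move=> th lam l0; apply: cvgM; last first.
    by apply: cvgD; apply: jcont_cst_mul => //; exact: jcont_heat.
  apply: cvgV; [by rewrite gt_eqF|exact: cvg_snd].
- move=> th lam l0; apply: cvgM; last first.
    by apply: cvgD; apply: jcont_cst_mul => //; exact: jcont_heat.
  apply: cvgV; [by rewrite gt_eqF|exact: cvg_snd].
Qed.

Lemma tame_heat_th n : tame (heat_th n).
Proof.
apply: tame_mul; first exact: tame_scaleV.
by apply: tame_add; apply: (tame_mul (tame_cst _ _)); exact: tame_heat.
Qed.

Lemma tame_heat_lam n : tame (heat_lam n).
Proof.
apply: tame_mul; first exact: tame_scaleV.
by apply: tame_add; apply: (tame_mul (tame_cst _ _)); exact: tame_heat.
Qed.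

Lemma rhoE : rho = fun th lam => heat 0 th lam + (2 * (lam^-1 * lam^-1)) * (2 * heat 2 th lam + - 1 * heat 0 th lam).
Proof. by apply/funext => th; apply/funext => lam; rewrite /rho expr2 invfM mulN1r. Qed.

Lemma tame_scaleVn n : tame (fun _ lam => lam^-1 ^+ n).
Proof.
elim: n => [|n IHn]; first exact: tame_cst.
have -> : (fun _ lam : R => lam^-1 ^+ n.+1) = (fun _ lam => lam^-1 * lam^-1 ^+ n).
  by apply/funext => th; apply/funext => lam; rewrite exprS.
by apply: tame_mul IHn; exact: tame_scaleV.
Qed.

Lemma chain_scaleV : chain (fun _ lam : R => lam^-1) (fun _ _ => 0)
  (fun _ lam => -1 * (lam^-1 * lam^-1)).
Proof.
apply: chain_scale => x x0; have Di := is_derive_inv (lt0r_neq0 x0).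
by apply: is_derive_eq; rewrite expr2 invfM mulN1r.
Qed.

Lemma chain_rho : exists gt gl, [/\ tame gt, tame gl & chain rho gt gl].
Proof.
rewrite rhoE; do 2 eexists; split; last first.
- apply: chain_add; first exact: chain_heat.
  apply: chain_mul.
    apply: chain_mul; first exact: (@chain_angle _ (cst 2) (cst 0)).
    by apply: chain_mul; exact: chain_scaleV.
  apply: chain_add; apply: chain_mul; try exact: chain_heat.
    exact: (@chain_angle _ (cst 2) (cst 0)).
  exact: (@chain_angle _ (cst (-1)) (cst 0)).
- repeat first [exact: tame_cst|exact: tame_heat|exact: tame_scaleV|exact: tame_scale|exact: tame_heat_th|exact: tame_heat_lam|apply: tame_add|apply: tame_mul].
- repeat first [exact: tame_cst|exact: tame_heat|exact: tame_scaleV|exact: tame_scale|exact: tame_heat_th|exact: tame_heat_lam|apply: tame_add|apply: tame_mul].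
Qed.

Lemma tame_rho : tame rho.
Proof.
rewrite rhoE; repeat first [exact: tame_cst|exact: tame_heat|exact: tame_scaleV|apply: tame_add|apply: tame_mul].
Qed.

(** The only generators whose derivatives are not visibly tame are the moments, whose
    derivatives are combinations of other moments, and the inverse of [rho], where the
    positivity of [rho] is needed. *)
Lemma tame_chain g : tame g -> exists gt gl, [/\ tame gt, tame gl & chain g gt gl].
Proof.
elim => [c|||||||| n||g1 g2 a1 [t1 [l1 [A1 B1 C1]]] a2 [t2 [l2 [A2 B2 C2]]]
  |g1 g2 a1 [t1 [l1 [A1 B1 C1]]] a2 [t2 [l2 [A2 B2 C2]]]].
- exists (fun _ _ => 0), (fun _ _ => 0); split; [exact: tame_cst|exact: tame_cst|].
  exact: (@chain_angle _ (cst c) (cst 0)).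
- exists (fun th _ => -1 * sin th), (fun _ _ => 0); split; last 1 first.
  + by apply: chain_angle => x; apply: is_derive_eq; rewrite mulN1r.
  + by apply: tame_mul; [exact: tame_cst|exact: tame_sin].
  + exact: tame_cst.
- exists (fun th _ => cos th), (fun _ _ => 0); split; [exact: tame_cos|exact: tame_cst|].
  exact: chain_angle.
- exists (fun _ _ => 0), (fun _ _ => 1); split; [exact: tame_cst|exact: tame_cst|].
  exact: (@chain_scale _ id (cst 1)).
- exists (fun _ _ => 0), (fun _ lam => -1 * (lam^-1 * lam^-1)).
  split; [exact: tame_cst| |exact: chain_scaleV].
  by apply: tame_mul; [exact: tame_cst|apply: tame_mul; exact: tame_scaleV].
- exists (fun _ _ => 0), (fun _ lam => 2^-1 * lam * expR (4^-1 * (lam * lam))).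
  split; [exact: tame_cst| |].
  + by apply: tame_mul; [apply: tame_mul; [exact: tame_cst|exact: tame_scale]|exact: tame_exp].
  + by apply: chain_scale => x _; apply: is_derive_eq; rewrite /GRing.scale /=; field.
- exists (fun _ _ => 0), (fun _ lam => - 2^-1 * lam * expR (- (4^-1 * (lam * lam)))).
  split; [exact: tame_cst| |].
  + by apply: tame_mul; [apply: tame_mul; [exact: tame_cst|exact: tame_scale]|exact: tame_expN].
  + by apply: chain_scale => x _; apply: is_derive_eq; rewrite /GRing.scale /=; field.
- exists (fun _ _ => 0), (fun _ lam => 4 * lam^-1 ^+ 5 * expR (- lam^-1 ^+ 4)).
  split; [exact: tame_cst| |].
  + by apply: tame_mul; [apply: tame_mul; [exact: tame_cst|exact: tame_scaleVn]|exact: tame_flat].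
  + apply: chain_scale => x x0; have Di := is_derive_inv (lt0r_neq0 x0).
    by apply: is_derive_eq; rewrite /GRing.scale /= expr2 invfM; ring.
- exists (heat_th n), (heat_lam n); split; [exact: tame_heat_th|exact: tame_heat_lam|exact: chain_heat].
- have [t [l [At Al Cr]]] := chain_rho.
  do 2 eexists; split; last first.
  + apply: chain_inv Cr => th lam l0; exact/lt0r_neq0/rho_gt0.
  + by do ! apply: tame_mul => //; [exact: tame_cst|exact: tame_rhoV|exact: tame_rhoV].
  + by do ! apply: tame_mul => //; [exact: tame_cst|exact: tame_rhoV|exact: tame_rhoV].
- do 2 eexists; split; last exact: (chain_add C1 C2); exact: tame_add.
- do 2 eexists; split; last exact: (chain_mul C1 C2);
  by apply: tame_add; apply: tame_mul.
Qed.

Lemma jcont_tame g : tame g -> jcont g.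
Proof.
elim => [c|||||||| n||g1 g2 _ c1 _ c2|g1 g2 _ c1 _ c2].
- by move=> th lam _; exact: cvg_cst.
- exact/jcont_angle/continuous_cos.
- exact/jcont_angle/continuous_sin.
- by apply: jcont_scale => x _; exact: cvg_id.
- by apply: jcont_scale => x x0; apply: cvgV; [rewrite gt_eqF|exact: cvg_id].
- apply: jcont_scale => x _; apply: (@is_derive_continuous _ _ _ (expR (4^-1 * (x * x)) * (4^-1 * (2 * x)))).
  by apply: is_derive_eq; rewrite /GRing.scale /=; ring.
- apply: jcont_scale => x _; apply: (@is_derive_continuous _ _ _ (expR (- (4^-1 * (x * x))) * - (4^-1 * (2 * x)))).
  by apply: is_derive_eq; rewrite /GRing.scale /=; ring.
- apply: jcont_scale => x x0; have Di := is_derive_inv (lt0r_neq0 x0).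
  apply: (@is_derive_continuous _ _ _ (expR (- x^-1 ^+ 4) * (4 * x^-1 ^+ 5))).
  by apply: is_derive_eq; rewrite /GRing.scale /= expr2 invfM; ring.
- exact: jcont_heat.
- move=> th lam l0; apply: cvgV; first exact/lt0r_neq0/rho_gt0.
  rewrite rhoE; apply: cvgD; first exact: jcont_heat.
  apply: cvgM; last by apply: cvgD; apply: jcont_cst_mul => //; exact: jcont_heat.
  have cV : z.2^-1 @[z --> (th, lam)] --> lam^-1.
    by apply: cvgV; [rewrite gt_eqF|exact: cvg_snd].
  by apply: cvgM; [exact: cvg_cst|exact: cvgM].
- by move=> th lam l0; apply: cvgD; [exact: c1|exact: c2].
- by move=> th lam l0; apply: cvgM; [exact: c1|exact: c2].
Qed.

Lemma heat_periodic n th lam : heat n (th + pi *+ 2) lam = heat n th lam.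
Proof.
apply: eq_Rintegral => v _; congr (_ * _).
by rewrite addrAC hper.
Qed.

Lemma rho_periodic th lam : rho (th + pi *+ 2) lam = rho th lam.
Proof. by rewrite /rho !heat_periodic. Qed.

Lemma tame_periodic g : tame g -> forall th lam, g (th + pi *+ 2) lam = g th lam.
Proof.
elim => //= [th _|th _|n th lam|th lam|g1 g2 _ H1 _ H2 th lam|g1 g2 _ H1 _ H2 th lam].
- exact: cosD2pi.
- exact: sinD2pi.
- exact: heat_periodic.
- by rewrite rho_periodic.
- by rewrite H1 H2.
- by rewrite H1 H2.
Qed.

Definition exp_growth (g : R -> R -> R) := exists B K : R, [/\ 0 <= B, 0 <= K &
  forall th lam, 0 < lam <= 1 -> `|g th lam| <= B * expR (K * lam^-1 ^+ 2)].

Lemma exp_growth_bounded g (B : R) : (forall th lam, 0 < lam <= 1 -> `|g th lam| <= B) ->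
  exp_growth g.
Proof.
move=> gB; exists B, 0; split => // [|th lam l01].
  by apply: le_trans (gB 0 1 _); rewrite // ltr01 lexx.
by rewrite mul0r expR0 mulr1 gB.
Qed.

(** The growth comes from the inverse of [rho], by the lower bound on the radius of
    curvature; all other generators grow at most like a power of [lam^-1]. *)
Lemma tame_growth g : tame g -> exp_growth g.
Proof.
elim => [c|||||||| n||g1 g2 _ [B1 [K1 [B10 K10 H1]]] _ [B2 [K2 [B20 K20 H2]]]
  |g1 g2 _ [B1 [K1 [B10 K10 H1]]] _ [B2 [K2 [B20 K20 H2]]]].
- exact: (@exp_growth_bounded _ `|c|).
- by apply: (@exp_growth_bounded _ 1) => th _ _; exact: cos_max.
- by apply: (@exp_growth_bounded _ 1) => th _ _; exact: sin_max.
- by apply: (@exp_growth_bounded _ 1) => _ lam /andP[l0 l1]; rewrite gtr0_norm.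
- exists 1, 1; split => // _ lam /andP[l0 l1]; rewrite !mul1r gtr0_norm ?invr_gt0 //.
  apply: le_trans (expR_ge1Dx _); rewrite expr2.
  have : 0 < lam^-1 by rewrite invr_gt0.
  nra.
- apply: (@exp_growth_bounded _ (expR 1)) => _ lam /andP[l0 l1].
  by rewrite gtr0_norm ?expR_gt0 // ler_expR; nra.
- apply: (@exp_growth_bounded _ 1) => _ lam /andP[l0 l1].
  by rewrite gtr0_norm ?expR_gt0 // -[leRHS]expR0 ler_expR; nra.
- apply: (@exp_growth_bounded _ 1) => _ lam /andP[l0 l1].
  by rewrite gtr0_norm ?expR_gt0 // -expR0 ler_expR oppr_le0 exprn_ge0 // invr_ge0 ltW.
- have [B B0 HB] := heat_bound hc hM n.
  by apply: (@exp_growth_bounded _ B) => th lam _; exact: HB.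
- exists P^-1, (pi ^+ 2); split => [||th lam /andP[l0 l1]]; first by rewrite invr_ge0 ltW.
    exact: sqr_ge0.
  have r0 := rho_gt0 th l0; rewrite gtr0_norm ?invr_gt0 //.
  rewrite -[leRHS]invrK lef_pV2 ?posrE //; last by rewrite invr_gt0 mulr_gt0 ?invr_gt0 ?expR_gt0.
  rewrite invfM invrK -expRN; apply: le_trans (hrho th l0).
  rewrite exprMn ler_pM2r ?expR_gt0 // ler_peMr ?(ltW P0) //.
  by rewrite invf_ge1.
- exists (B1 + B2), (K1 + K2); split; rewrite ?addr_ge0 // => th lam l01.
  rewrite (le_trans (ler_normD _ _)) // mulrDl; apply: lerD.
  + apply: le_trans (H1 _ _ l01) _; rewrite ler_wpM2l // ler_expR ler_wpM2r ?sqr_ge0 //.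
    by rewrite lerDl.
  + apply: le_trans (H2 _ _ l01) _; rewrite ler_wpM2l // ler_expR ler_wpM2r ?sqr_ge0 //.
    by rewrite lerDr.
- exists (B1 * B2), (K1 + K2); split; rewrite ?mulr_ge0 ?addr_ge0 // => th lam l01.
  rewrite normrM mulrDl expRD mulrACA; apply: ler_pM => //; [exact: H1|exact: H2].
Qed.

End tame_functions.

(** * Orbits and rotating frames *)

Lemma ord2 (i : 'I_2) : i = 0 \/ i = 1.
Proof. by case: i => [[|[|//]] hi]; [left|right]; apply: val_inj. Qed.

Lemma row2P {R : Type} (u v : 'rV[R]_2) : u 0 0 = v 0 0 -> u 0 1 = v 0 1 -> u = v.
Proof. by move=> e0 e1; apply/rowP => i; case: (ord2 i) => ->. Qed.

Section orbits.
Context {R : realType}.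

Lemma is_derive_row n (M : R -> 'rV[R]_n) (t : R) (d : 'rV[R]_n) :
  (forall i, is_derive t 1 (fun s => M s 0 i) (d 0 i)) -> is_derive t 1 M d.
Proof.
move=> D; have dM : derivable M t 1.
  by apply/derivable_mxP => i j; rewrite (ord1 i); case: (D j).
apply: (DeriveDef dM); rewrite derive_mx //; apply/rowP => j; rewrite mxE.
by have [_] := D j.
Qed.

(** Directional derivatives only depend on the restriction to a line, so they can be
    computed by one-variable calculus. *)
Lemma is_derive_line (f : 'rV[R]_2 -> R) (x v : 'rV[R]_2) (l : R) :
  is_derive (0 : R) 1 (fun e : R => f (x + e *: v)) l -> is_derive x v f l.
Proof.
move=> [dF DF]; have E : (fun h : R => h^-1 *: ((f \o shift x) (h *: v) - f x)) =
  (fun h : R => h^-1 *: (((fun e : R => f (x + e *: v)) \o shift 0) (h *: 1) -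
     (fun e : R => f (x + e *: v)) 0)).
  apply/funext => h /=; rewrite addr0 scale0r addr0 (addrC x).
  by congr (_ *: (f (_ *: _ + _) - _)); rewrite /GRing.scale /= mulr1.
by split; [rewrite /derivable E|rewrite /derive E].
Qed.

Lemma level_orbit_total n (U : 'rV[R]_n -> R) (q : R -> 'rV[R]_n) :
  (forall t : R, derivable q t 1) -> (forall t : R, derivable q^`() t 1) ->
  (forall t : R, q^`(2) t = - grad U (q t)) -> (forall s t, U (q s) = U (q t)) ->
  level_orbit U setT q.
Proof.
move=> d1 d2 eqn cst; split; last by move=> s t _ _; exact: cst.
split; last by move=> J p TJ _ _; apply/seteqP; split => // t _; exact: TJ.
split; [by exists 0|exact: openT|by []|by move=> t _; split].
Qed.

Lemma level_orbit_cst n (U : 'rV[R]_n -> R) (x : 'rV[R]_n) : grad U x = 0 ->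
  level_orbit U setT (cst x).
Proof.
move=> gx; have d1 : (cst x : R -> 'rV[R]_n)^`() = cst 0.
  by apply/funext => t; rewrite derive1_cst.
apply: level_orbit_total => // t.
- by rewrite d1; exact: derivable_cst.
- by rewrite derive1nS derive1n1 d1 derive1_cst gx oppr0.
Qed.

(** The global solution of [g' = 1 / r g], obtained as the inverse of an antiderivative of
    [r]. It gives the normal angle as a function of arc length. *)
Lemma inverse_flow (L r : R -> R) (m : R) : 0 < m ->
  (forall x : R, is_derive x 1 L (r x)) -> (forall x, m <= r x) ->
  exists g : R -> R, forall y : R, L (g y) = y /\ is_derive y 1 g (r (g y))^-1.
Proof.
move=> m0 DL mr; have gap a b : a <= b -> m * (b - a) <= L b - L a.
  rewrite le_eqVlt => /predU1P[->|ab]; first by rewrite !subrr mulr0.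
  have [c _ ->] := mvt ab (fun x _ => DL x).
  by rewrite ler_pM2r ?subr_gt0.
have cL : continuous L by move=> x; exact: is_derive_continuous (DL x).
have inj : injective L.
  move=> a b E; wlog ab : a b E / a <= b => [IH|].
    by have [/IH|/ltW /IH] := leP a b; [exact|move=> <-].
  have := gap _ _ ab; rewrite E subrr pmulr_rle0 // subr_le0 => ba.
  by apply/eqP; rewrite eq_le ab.
have surj y : exists x, L x = y.
  pose N := `|y - L 0| / m; have N0 : 0 <= N by rewrite divr_ge0 // ltW.
  have Nm : m * N = `|y - L 0| by rewrite /N mulrC divfK // lt0r_neq0.
  have h1 := gap _ _ N0.
  have N0' : - N <= 0 by rewrite oppr_le0.
  have h2 := gap _ _ N0'; rewrite subr0 Nm in h1; rewrite sub0r opprK Nm in h2.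
  have y1 := ler_norm (y - L 0); have y2 := ler_norm (- (y - L 0)); rewrite normrN in y2.
  have NN : - N <= N by rewrite (le_trans N0').
  have [|c _ Lc] := IVT (v := y) NN (continuous_subspaceT cL); last by exists c.
  by rewrite ge_min le_max; apply/andP; split; apply/orP; [left|right]; lra.
have [g gL] := choice surj; exists g => y; split => //.
have lg : cancel L g by move=> x; apply: inj; rewrite gL.
have r0 : r (g y) != 0 by rewrite gt_eqF // (lt_le_trans m0).
have n1 : {near g y, cancel L g} by apply/nbhs_ballP; exists 1 => //= x _; exact: lg.
have n2 : {near g y, continuous L} by apply/nbhs_ballP; exists 1 => //= x _; exact: cL.
by have := is_derive_inverse n1 n2 (DL (g y)) r0; rewrite gL.
Qed.

(** The envelope of the lines with support function [s] is traversed with speed [v] in the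
    tangent direction if the normal angle has speed [v / r], with [r = s + s'']. *)
Lemma is_derive_envelope_point (s ds psi : R -> R) (t v r : R) :
  is_derive (psi t) 1 s (ds (psi t)) -> is_derive (psi t) 1 ds (r - s (psi t)) ->
  is_derive t 1 psi (v / r) -> r != 0 ->
  is_derive t 1 (fun x => s (psi x) * cos (psi x) - ds (psi x) * sin (psi x)) (v * - sin (psi t)) /\
  is_derive t 1 (fun x => s (psi x) * sin (psi x) + ds (psi x) * cos (psi x)) (v * cos (psi t)).
Proof.
move=> D1 D2 D3 r0; split; apply: is_derive_eq; rewrite /GRing.scale /=; field; exact: r0.
Qed.

End orbits.

(** * Angles and Sturm comparison *)

Section angles.
Context {R : realType}.

Definition ip (x : 'rV[R]_2) (th : R) : R := x 0 0 * cos th + x 0 1 * sin th.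
Definition ipt (x : 'rV[R]_2) (th : R) : R := x 0 1 * cos th - x 0 0 * sin th.

Definition dist1 (x y : 'rV[R]_2) : R := `|y 0 0 - x 0 0| + `|y 0 1 - x 0 1|.

Lemma ip_dist x y th : `|ip y th - ip x th| <= dist1 x y.
Proof.
have -> : ip y th - ip x th = (y 0 0 - x 0 0) * cos th + (y 0 1 - x 0 1) * sin th.
  by rewrite /ip; ring.
rewrite (le_trans (ler_normD _ _)) // !normrM lerD // ler_piMr //; [exact: cos_max|exact: sin_max].
Qed.

Lemma is_derive_ip x (th : R) : is_derive th 1 (ip x) (ipt x th).
Proof. by rewrite /ip; apply: is_derive_eq; rewrite /GRing.scale /= /ipt; ring. Qed.

Lemma is_derive_ipt x (th : R) : is_derive th 1 (ipt x) (- ip x th).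
Proof. by rewrite /ipt; apply: is_derive_eq; rewrite /GRing.scale /= /ip; ring. Qed.

Lemma periodic_int (f : R -> R) : (forall x, f (x + pi *+ 2) = f x) ->
  forall x (k : int), f (x + pi *+ 2 * k%:~R) = f x.
Proof.
move=> fp x k.
have nat_case n y : f (y + pi *+ 2 * n%:R) = f y.
  by rewrite mulr_natr; exact: (periodicn fp).
case: k => n; first exact: nat_case.
rewrite NegzE mulrNz mulrN -[in RHS](subrK (pi *+ 2 * n.+1%:R) x).
by rewrite nat_case.
Qed.

Lemma ip_periodic x th : ip x (th + pi *+ 2) = ip x th.
Proof. by rewrite /ip cosD2pi sinD2pi. Qed.

Lemma ipt_periodic x th : ipt x (th + pi *+ 2) = ipt x th.
Proof. by rewrite /ipt cosD2pi sinD2pi. Qed.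

Lemma angle_rep (a : R) : exists k : int, `|a + pi *+ 2 * k%:~R| <= pi.
Proof.
have p0 : 0 < (pi *+ 2 : R) by rewrite mulr2n addr_gt0 // pi_gt0.
pose t := (a + pi) / (pi *+ 2); exists (- Num.floor t).
have /andP[f1 f2] := Num.Theory.floor_itv t.
move: f1 f2; rewrite /t ler_pdivlMr // ltr_pdivrMr // intrD mulrDl => f1 f2.
rewrite mulrNz mulrN mulrC ler_norml; apply/andP; split; lra.
Qed.

(** The angular distance is controlled by [1 - cos], the quantity that Sturm comparison
    produces. *)
Lemma cos_lt (a e : R) : 0 < e -> `|a| <= pi -> 1 - cos a < 1 - cos (Num.min e pi) -> `|a| < e.
Proof.
move=> e0 api; rewrite ltrD2l ltrN2 -(cos_norm a) => H.
have : `|a| < Num.min e pi.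
  rewrite ltNge; apply/negP => H2; move: H; rewrite ltNge => /negP; apply.
  move: H2; rewrite le_eqVlt => /predU1P[->//|H2].
  have i1 : `|a| \in `[0, pi]%R by rewrite in_itv /= normr_ge0.
  have i2 : Num.min e pi \in `[0, pi]%R.
    by rewrite in_itv /= le_min (ltW e0) pi_ge0 /= ge_min lexx orbT.
  by apply: ltW; rewrite ltr_cos.
by rewrite lt_min => /andP[].
Qed.

(** A derivative read off from a slope function that factors the increments near the
    point; the value of the slope function at the point itself does not matter. *)
Lemma is_derive_slope (f q : R -> R) (t l : R) :
  (\forall e \near t, f e - f t = q e * (e - t)) -> q e @[e --> t] --> l ->
  is_derive t 1 f l.
Proof.
move=> fq ql; apply/is_derive1_caratheodory.
exists (fun e => if e == t then l else (f e - f t) / (e - t)); split.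
- move=> e; case: eqP => [->|/eqP et]; first by rewrite !subrr mulr0.
  by rewrite divfK // subr_eq0.
- change ((fun e => if e == t then l else (f e - f t) / (e - t)) e @[e --> t] -->
    (if t == t then l else (f t - f t) / (t - t))); rewrite eqxx.
  apply/cvgrPdist_lt => d d0; move/cvgrPdist_lt: ql => /(_ _ d0).
  apply: filterS2 fq => e fe qe; case: eqP => [_|/eqP et]; first by rewrite subrr normr0.
  by rewrite fe mulfK // subr_eq0.
- by rewrite eqxx.
Qed.

(** Variation of constants: [z a = v' a * sin (b - a) + v a * cos (b - a)] goes from [0] to
    [v b] when [a] goes from [0] to [b], and its derivative [(v'' + v) * sin (b - a)] has
    the right sign as long as [b] is at most half a turn. *)
Lemma sturm_comparison (v dv ddv : R -> R) :
  (forall a : R, is_derive a 1 v (dv a)) -> (forall a : R, is_derive a 1 dv (ddv a)) ->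
  v 0 = 0 -> dv 0 = 0 -> (forall a, 0 <= ddv a + v a) ->
  forall b, `|b| <= pi -> 0 <= v b.
Proof.
move=> Dv Ddv v0 dv0 pos b; rewrite ler_norml => /andP[b1 b2].
pose z a := dv a * sin (b - a) + v a * cos (b - a).
have Dz (a : R) : is_derive a 1 z ((ddv a + v a) * sin (b - a)).
  have D1 := Dv a; have D2 := Ddv a.
  by rewrite /z; apply: is_derive_eq; rewrite /GRing.scale /=; ring.
have z0 : z 0 = 0 by rewrite /z v0 dv0 !mul0r addr0.
have zb : z b = v b by rewrite /z subrr sin0 cos0 mulr0 add0r mulr1.
rewrite -zb; have [b0|b0] := leP 0 b.
- rewrite -z0; apply: (@nondecreasing_derive _ z (fun a => (ddv a + v a) * sin (b - a))) => //.
  by move=> a /andP[a0 ab]; rewrite mulr_ge0 // sin_ge0_pi // subr_ge0 ab lerBlDr ler_wpDr.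
- rewrite -oppr_le0 -(oppr0) -z0.
  apply: (@nondecreasing_derive _ (fun a => - z a) (fun a => - ((ddv a + v a) * sin (b - a)))); first exact: ltW.
  move=> a /andP[ab a0]; rewrite -mulrN mulr_ge0 // -sinN opprB sin_ge0_pi // subr_ge0 ab.
  by rewrite lerBlDr (le_trans a0) // -lerBlDl sub0r.
Qed.

(** A convex curve with curvature radius at least [m] lies outside the circle of radius [m]
    that touches it from the inside. Here [i], a solution of [i'' + i = 0], is the support
    function of the point of contact, and [m * (1 - cos b)] is the distance of the tangent
    line at angle [th + b] from that point in the case of a circle. *)
Lemma support_comparison (s ds r i it : R -> R) (m th : R) :
  (forall t : R, is_derive t 1 s (ds t)) -> (forall t : R, is_derive t 1 ds (r t - s t)) ->
  (forall t : R, is_derive t 1 i (it t)) -> (forall t : R, is_derive t 1 it (- i t)) ->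
  s th = i th -> ds th = it th -> (forall t, m <= r t) ->
  forall b, `|b| <= pi -> m * (1 - cos b) <= s (th + b) - i (th + b).
Proof.
move=> Ds Dds Di Dit e1 e2 mr b bpi.
pose v a := s (th + a) - i (th + a) - m * (1 - cos a).
pose dv a := ds (th + a) - it (th + a) - m * sin a.
pose ddv a := r (th + a) - s (th + a) + i (th + a) - m * cos a.
have Dv (a : R) : is_derive a 1 v (dv a).
  have D1 := Ds (th + a); have D2 := Di (th + a).
  rewrite /v; apply: is_derive_eq; rewrite /GRing.scale /= /dv; ring.
have Ddv (a : R) : is_derive a 1 dv (ddv a).
  have D1 := Dds (th + a); have D2 := Dit (th + a).
  rewrite /dv; apply: is_derive_eq; rewrite /GRing.scale /= /ddv; ring.
have v0 : v 0 = 0 by rewrite /v addr0 e1 cos0 !subrr mulr0 subr0.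
have dv0 : dv 0 = 0 by rewrite /dv addr0 e2 sin0 subrr mulr0 subr0.
have pos a : 0 <= ddv a + v a.
  have -> : ddv a + v a = r (th + a) - m by rewrite /ddv /v; ring.
  by rewrite subr_ge0.
by rewrite -subr_ge0; exact: (sturm_comparison Dv Ddv v0 dv0 pos bpi).
Qed.

End angles.

(** * The moving convex curves *)

Section envelope.
Context {R : realType} (h0 : R -> R) (M P : R).
Hypothesis hc : continuous h0.
Hypothesis hM : forall x, `|h0 x| <= M.
Hypothesis hper : forall x, h0 (x + pi *+ 2) = h0 x.
Hypothesis P0 : 0 < P.
Hypothesis hrho : forall th lam : R, 0 < lam ->
  P / lam * expR (- (pi / lam) ^+ 2) <= rho h0 th lam.
Local Notation tame := (tame h0).

(** The factor [exp t] of the solution of [h_t = h + h''] at time [t = lam ^ 2 / 4], together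
    with the normalization of the Gaussian. *)
Definition weight (lam : R) : R := (Num.sqrt pi)^-1 * expR (4^-1 * (lam * lam)).
Definition supp (th lam : R) : R := weight lam * heat h0 0 th lam.
Definition dsupp (th lam : R) : R := weight lam * (2 * lam^-1 * heat h0 1 th lam).
(** The radius of curvature [supp + supp''], see [is_derive_dsupp_th]. *)
Definition rad (th lam : R) : R := weight lam * rho h0 th lam.
Definition radV (th lam : R) : R :=
  Num.sqrt pi * expR (- (4^-1 * (lam * lam))) * (rho h0 th lam)^-1.

Let spi0 : 0 < Num.sqrt pi :> R. Proof. by rewrite sqrtr_gt0 pi_gt0. Qed.

Lemma weight_ge lam : (Num.sqrt pi)^-1 <= weight lam.
Proof.
rewrite /weight ler_peMr ?invr_ge0 ?sqrtr_ge0 // -[leLHS]expR0 ler_expR.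
by rewrite mulr_ge0 // -expr2 sqr_ge0.
Qed.

Lemma weight_gt0 lam : 0 < weight lam.
Proof. by rewrite mulr_gt0 ?expR_gt0 // invr_gt0. Qed.

Lemma rad_gt0 th lam : 0 < lam -> 0 < rad th lam.
Proof. by move=> l0; rewrite mulr_gt0 ?weight_gt0 // (rho_gt0 P0 hrho). Qed.

Lemma radVE th lam : radV th lam = (rad th lam)^-1.
Proof. by rewrite /radV /rad /weight !invfM invrK expRN. Qed.

Lemma is_derive_weight (lam : R) : is_derive lam 1 weight (lam / 2 * weight lam).
Proof. by apply: is_derive_eq; rewrite /GRing.scale /= /weight; field; exact: lt0r_neq0. Qed.

Lemma is_derive_supp_th (th lam : R) : 0 < lam -> is_derive th 1 (supp ^~ lam) (dsupp th lam).
Proof.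
move=> l0; have D := is_derive_heat_th hc hM 0 th l0.
by rewrite /supp; apply: is_derive_eq; rewrite /GRing.scale /= /dsupp; ring.
Qed.

Lemma is_derive_dsupp_th (th lam : R) : 0 < lam ->
  is_derive th 1 (dsupp ^~ lam) (rad th lam - supp th lam).
Proof.
move=> l0; have D := is_derive_heat_th hc hM 1 th l0.
rewrite /dsupp; apply: is_derive_eq; rewrite /GRing.scale /= /rad /supp /rho.
by field; exact: lt0r_neq0.
Qed.

(** Inverse curvature flow: at time [lam ^ 2 / 4], whose derivative is [lam / 2], the normal
    speed is the radius of curvature. *)
Lemma is_derive_supp_lam (th lam : R) : 0 < lam ->
  is_derive lam 1 (supp th) (lam / 2 * rad th lam).
Proof.
move=> l0; have D := is_derive_heat_lam hc hM 0 th l0; have D2 := is_derive_weight lam.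
rewrite /supp; apply: is_derive_eq; rewrite /GRing.scale /= /rad /rho.
by field; exact: lt0r_neq0.
Qed.

Lemma tame_weight : tame (fun _ lam => weight lam).
Proof. by apply: tame_mul; [exact: tame_cst|exact: tame_exp]. Qed.

Lemma tame_supp : tame supp.
Proof. by apply: tame_mul; [exact: tame_weight|exact: tame_heat]. Qed.

Lemma tame_dsupp : tame dsupp.
Proof.
apply: tame_mul; first exact: tame_weight.
by apply: tame_mul; [apply: tame_mul; [exact: tame_cst|exact: tame_scaleV]|exact: tame_heat].
Qed.

Lemma tame_rad : tame rad.
Proof. by apply: tame_mul; [exact: tame_weight|exact: tame_rho]. Qed.

Lemma tame_radV : tame radV.
Proof.
apply: tame_mul; last exact: tame_rhoV.
by apply: tame_mul; [exact: tame_cst|exact: tame_expN].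
Qed.

(** A lower bound, uniform in the angle and increasing in [lam], for the speed at which the
    support function grows. *)
Definition rate (lam : R) : R := (Num.sqrt pi)^-1 * P / 2 * expR (- (pi / lam) ^+ 2).

Lemma rate_gt0 lam : 0 < rate lam.
Proof. by rewrite mulr_gt0 ?expR_gt0 // divr_gt0 // mulr_gt0 // invr_gt0. Qed.

Lemma rate_le lam mu : 0 < lam <= mu -> rate lam <= rate mu.
Proof.
move=> /andP[l0 lm]; have m0 := lt_le_trans l0 lm.
rewrite ler_wpM2l //; first by rewrite ltW // divr_gt0 // mulr_gt0 // invr_gt0.
rewrite ler_expR lerN2; apply: lerXn2r.
- by rewrite nnegrE divr_ge0 ?pi_ge0 // ltW.
- by rewrite nnegrE divr_ge0 ?pi_ge0 // ltW.
- by rewrite ler_pM2l ?pi_gt0 // lef_pV2.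
Qed.

Lemma rate_le_rad th lam : 0 < lam -> rate lam <= lam / 2 * rad th lam.
Proof.
move=> l0; have H := hrho th l0; have w := weight_ge lam.
have E0 := expR_gt0 (- (pi / lam) ^+ 2).
apply: (@le_trans _ _ (lam / 2 * ((Num.sqrt pi)^-1 * (P / lam * expR (- (pi / lam) ^+ 2))))).
  rewrite le_eqVlt; apply/orP; left; apply/eqP; rewrite /rate; field.
  by rewrite !lt0r_neq0.
rewrite ler_pM2l ?divr_gt0 // /rad; apply: ler_pM w H; first by rewrite invr_ge0 ltW.
by rewrite ltW // mulr_gt0 // divr_gt0.
Qed.

Lemma supp_gap th lam mu : 0 < lam <= mu -> rate lam * (mu - lam) <= supp th mu - supp th lam.
Proof.
move=> /andP[l0]; rewrite le_eqVlt => /predU1P[<-|lm]; first by rewrite !subrr mulr0.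
have [|c /andP[lc cm] ->] := @mvt _ (supp th) (fun l => l / 2 * rad th l) _ _ lm.
  by move=> x /andP[lx _]; apply: is_derive_supp_lam; exact: lt_le_trans lx.
have c0 := lt_trans l0 lc.
rewrite ler_pM2r ?subr_gt0 // (le_trans _ (rate_le_rad th c0)) // rate_le // l0; exact: ltW.
Qed.

Lemma supp_lt th lam mu : 0 < lam < mu -> supp th lam < supp th mu.
Proof.
move=> /andP[l0 lm]; rewrite -subr_gt0.
by apply: lt_le_trans (supp_gap th _); rewrite ?l0 ?ltW // mulr_gt0 ?rate_gt0 ?subr_gt0.
Qed.

Lemma supp_le th lam mu : 0 < lam <= mu -> supp th lam <= supp th mu.
Proof.
move=> /andP[l0]; rewrite le_eqVlt => /predU1P[-> //|lm].
by apply/ltW/supp_lt; rewrite l0.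
Qed.

Lemma supp_cvg0 th : supp th lam @[lam --> 0^'+] --> h0 th.
Proof.
apply: cvg_at_right_filter.
have -> : h0 th = weight 0 * (Num.sqrt pi * h0 th).
  by rewrite /weight mul0r mulr0 expR0 mulr1 mulKf // lt0r_neq0.
apply: cvgM; first exact: (is_derive_continuous (is_derive_weight 0)).
rewrite -heat0_at0; exact: heat0_continuous_at0 hc hM th.
Qed.

(** The support function increases strictly in the scale and starts at [h0]. *)
Lemma supp_gt th lam : 0 < lam -> h0 th < supp th lam.
Proof.
move=> l0; apply: (@le_lt_trans _ _ (supp th (lam / 2))); last first.
  by apply: supp_lt; rewrite divr_gt0 //= gtr_pMr // invf_lt1 // ltr1n.
rewrite leNgt; apply/negP => H.
have hn : \forall l \near (0 : R)^'+, supp th (lam / 2) < supp th l.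
  by apply: (cvgr_gt (h0 th)) => //; exact: supp_cvg0.
near (0 : R)^'+ => l.
have : supp th (lam / 2) < supp th l by near: l; exact: hn.
rewrite ltNge => /negP; apply; apply: supp_le; apply/andP; split.
  by near: l; exact: nbhs_right_gt.
by near: l; apply: nbhs_right_le; rewrite divr_gt0.
Unshelve. all: by end_near. Qed.

Lemma rad_bounded (a b : R) : 0 < a -> exists2 K, 0 <= K & forall th lam, a <= lam <= b ->
  lam / 2 * rad th lam <= K.
Proof.
move=> a0; have [B0 B00 H0] := heat_bound hc hM 0; have [B2 B20 H2] := heat_bound hc hM 2.
have D0 : 0 <= 2 * B2 + B0 by rewrite addr_ge0 // mulr_ge0.
have c0 : 0 <= 2 / a ^+ 2 by rewrite divr_ge0 // sqr_ge0.
exists (`|b| / 2 * (weight b * (B0 + 2 / a ^+ 2 * (2 * B2 + B0)))) => [|th lam /andP[al lb]].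
  have w0 := ltW (weight_gt0 b).
  by rewrite mulr_ge0 ?divr_ge0 // mulr_ge0 // addr_ge0 // mulr_ge0.
have l0 := lt_le_trans a0 al; have b0 := lt_le_trans l0 lb.
have r0 := rho_gt0 P0 hrho th l0.
apply: ler_pM.
- by rewrite divr_ge0 // ltW.
- by rewrite ltW // rad_gt0.
- by rewrite ler_pM2r ?invr_gt0 // (le_trans lb) // ler_norm.
apply: ler_pM; rewrite ?(ltW (weight_gt0 _)) ?(ltW r0) //.
  by rewrite ler_pM2l ?invr_gt0 // ler_expR; nra.
have h0' := le_trans (ler_norm _) (H0 th lam).
have h2' := le_trans (ler_norm _) (H2 th lam).
have h0n : - heat h0 0 th lam <= B0 by apply: le_trans (H0 th lam); rewrite -normrN ler_norm.
rewrite /rho; apply: lerD => //.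
apply: (@le_trans _ _ (2 / lam ^+ 2 * (2 * B2 + B0))).
  by rewrite ler_wpM2l ?divr_ge0 ?sqr_ge0 // lerD // ler_pM2l.
rewrite ler_wpM2r // ler_pM2l // lef_pV2 ?posrE ?exprn_gt0 //.
by apply: lerXn2r => //; rewrite nnegrE ltW.
Qed.

(** [x] is the point with outer normal angle [th] on the curve of scale [lam]: the two
    equations say that [x] lies on the tangent line at [th] and is where this line meets
    its neighbours. *)
Definition polar (x : 'rV[R]_2) (th lam : R) :=
  [/\ 0 < lam, ip x th = supp th lam & ipt x th = dsupp th lam].

Definition point (th lam : R) : 'rV[R]_2 :=
  \row_i (if i == 0 then supp th lam * cos th - dsupp th lam * sin th
          else supp th lam * sin th + dsupp th lam * cos th).

Lemma polar_point th lam : 0 < lam -> polar (point th lam) th lam.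
Proof.
move=> l0; have t := cos2Dsin2 th; split => //; rewrite /ip /ipt !mxE /=.
- rewrite -[RHS]mulr1 -t; ring.
- rewrite -[RHS]mulr1 -t; ring.
Qed.

Lemma supp_periodic th lam : supp (th + pi *+ 2) lam = supp th lam.
Proof. exact: (tame_periodic hper tame_supp). Qed.

Lemma dsupp_periodic th lam : dsupp (th + pi *+ 2) lam = dsupp th lam.
Proof. exact: (tame_periodic hper tame_dsupp). Qed.

Lemma polar_int x th lam (k : int) : polar x th lam -> polar x (th + pi *+ 2 * k%:~R) lam.
Proof.
move=> [l0 e1 e2]; split => //.
- rewrite (periodic_int (ip_periodic x)).
  by rewrite (periodic_int (f := supp ^~ lam)) // => y; exact: supp_periodic.
- rewrite (periodic_int (ipt_periodic x)).
  by rewrite (periodic_int (f := dsupp ^~ lam)) // => y; exact: dsupp_periodic.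
Qed.

(** The difference [supp - ip x] vanishes to first order at [th], and adding its second
    derivative to it gives the radius of curvature, so Sturm comparison applies. The
    resulting bound is the strict convexity behind [polar_unique] and
    [polar_angle_stable]. *)
Lemma polar_gap x th lam m : polar x th lam -> (forall a, m <= rad a lam) ->
  forall ph, m * (1 - cos (ph - th)) <= supp ph lam - ip x ph.
Proof.
move=> [l0 e1 e2] mr ph.
have [k Hk] := angle_rep (ph - th).
have H := support_comparison (fun t => is_derive_supp_th t l0) (fun t => is_derive_dsupp_th t l0)
  (is_derive_ip x) (is_derive_ipt x) (esym e1) (esym e2) mr Hk.
move: H; rewrite addrA (addrC th) subrK.
rewrite (periodic_int (ip_periodic x)) (periodic_int (@cosD2pi R)).
by rewrite (periodic_int (f := supp ^~ lam)) // => y; exact: supp_periodic.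
Qed.

Lemma rad_lower lam : 0 < lam -> exists2 m, 0 < m & forall a, m <= rad a lam.
Proof.
move=> l0; exists (rate lam * (2 / lam)).
  by rewrite mulr_gt0 ?rate_gt0 // divr_gt0.
move=> a; rewrite -ler_pdivlMr ?divr_gt0 // invf_div mulrC; exact: rate_le_rad.
Qed.

Lemma polar_le x th lam : polar x th lam -> forall ph, ip x ph <= supp ph lam.
Proof.
move=> px ph; have [l0 _ _] := px; have [m m0 Hm] := rad_lower l0.
rewrite -subr_ge0; apply: le_trans (polar_gap px Hm ph).
by rewrite mulr_ge0 ?(ltW m0) // subr_ge0 cos_le1.
Qed.

Lemma polar_scale_le x th lam y ph mu : polar x th lam -> polar y ph mu ->
  supp ph mu - supp ph lam <= dist1 x y.
Proof.
move=> px [m0 e1 _]; rewrite -e1; apply: le_trans (ip_dist x y ph).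
by apply: le_trans (ler_norm _); rewrite lerD2l lerN2; exact: polar_le px ph.
Qed.

Lemma dist1C x y : dist1 x y = dist1 y x :> R.
Proof. by rewrite /dist1 distrC (distrC (y 0 1)). Qed.

(** The curves are separated: those whose scales differ by [f] are at a distance of at
    least [rate * f]. *)
Lemma polar_scale_stable x th lam e : polar x th lam -> 0 < e -> exists2 d, 0 < d &
  forall y ph mu, polar y ph mu -> dist1 x y < d -> `|mu - lam| < e.
Proof.
move=> px e0; have [l0 _ _] := px.
pose f := Num.min e (lam / 2).
have f0 : 0 < f by rewrite lt_min e0 divr_gt0.
have fe : f <= e by rewrite ge_min lexx.
have fl : f <= lam / 2 by rewrite ge_min lexx orbT.
have l20 : 0 < lam / 2 by rewrite divr_gt0.
exists (rate (lam / 2) * f) => [|y ph mu py dxy]; first by rewrite mulr_gt0 // rate_gt0.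
have [m0 _ _] := py.
apply: lt_le_trans fe; rewrite ltr_norml; apply/andP; split; rewrite ltNge; apply/negP => H.
- have g1 : 0 < lam - f <= lam by apply/andP; split; lra.
  have g2 : 0 < mu <= lam - f by rewrite m0 /=; lra.
  have g3 : 0 < lam / 2 <= lam - f by rewrite l20 /=; lra.
  have := polar_scale_le py px; rewrite dist1C => h.
  have h1 := supp_gap th g1; have h2 := supp_le th g2; have h3 := rate_le g3.
  have h4 : rate (lam / 2) * f <= rate (lam - f) * f by rewrite ler_pM2r.
  have h5 : lam - (lam - f) = f by ring.
  rewrite h5 in h1; lra.
- have g1 : 0 < lam <= lam + f by rewrite l0 /=; lra.
  have g2 : 0 < lam + f <= mu by apply/andP; split; lra.
  have g3 : 0 < lam / 2 <= lam by rewrite l20 /=; lra.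
  have h := polar_scale_le px py.
  have h1 := supp_gap ph g1; have h2 := supp_le ph g2; have h3 := rate_le g3.
  have h4 : rate (lam / 2) * f <= rate lam * f by rewrite ler_pM2r.
  have h5 : lam + f - lam = f by ring.
  rewrite h5 in h1; lra.
Qed.

(** If [y] is close to [x], then its scale is close by the previous lemma, so [x] nearly
    reaches its own tangent line at the angle [ph] of [y]. By [polar_gap] this forces [ph]
    to be close to [th]. *)
Lemma polar_angle_stable x th lam e : polar x th lam -> 0 < e -> exists2 d, 0 < d &
  forall y ph mu, polar y ph mu -> dist1 x y < d -> 1 - cos (ph - th) < e.
Proof.
move=> px e0; have [l0 _ _] := px.
have l20 : 0 < lam / 2 by rewrite divr_gt0.
have [m m0 Hm] := rad_lower l0; have [K K0 HK] := rad_bounded lam l20.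
have K1 : 0 < K + 1 by rewrite ltr_wpDl.
pose f := Num.min (m * e / (2 * (K + 1))) (lam / 2).
have f0 : 0 < f by rewrite lt_min l20 andbT divr_gt0 ?mulr_gt0.
have f1 : f <= m * e / (2 * (K + 1)) by rewrite ge_min lexx.
have f2 : f <= lam / 2 by rewrite ge_min lexx orbT.
have [d1 d10 Hd1] := polar_scale_stable px f0.
exists (Num.min d1 (m * e / 2)) => [|y ph mu py]; first by rewrite lt_min d10 divr_gt0 // mulr_gt0.
rewrite lt_min => /andP[dxy1 dxy2]; have mu1 := Hd1 _ _ _ py dxy1.
have [mu0 ey _] := py.
have gap := polar_gap px Hm ph.
have Kf : K * f <= m * e / 2.
  apply: (@le_trans _ _ ((K + 1) * (m * e / (2 * (K + 1))))).
    by apply: ler_pM => //; [exact: ltW|rewrite lerDl].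
  by rewrite le_eqVlt; apply/orP; left; apply/eqP; field; exact: lt0r_neq0.
have small : supp ph lam - supp ph mu <= K * f.
  have [lm|ml] := leP lam mu.
    apply: (@le_trans _ _ 0); first by rewrite subr_le0 supp_le // l0.
    by rewrite mulr_ge0 // ltW.
  have [|c /andP[cm cl] ->] := @mvt _ (supp ph) (fun l => l / 2 * rad ph l) _ _ ml.
    by move=> z /andP[mz _]; apply: is_derive_supp_lam; exact: lt_le_trans mz.
  apply: ler_pM.
  - by rewrite (le_trans _ (rate_le_rad ph _)) ?(ltW (rate_gt0 _)) // (lt_trans mu0).
  - by rewrite subr_ge0 ltW.
  - by apply: HK; rewrite (ltW cl) andbT; move: mu1; rewrite ltr_norml; lra.
  - by move: mu1; rewrite ltr_norml; lra.
have d := ip_dist x y ph; have d' := le_trans (ler_norm _) d.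
rewrite -(ltr_pM2l m0); lra.
Qed.

(** The smaller of two scales would give a convex curve that encloses [x] and lies strictly
    inside the other one, and on a strictly convex curve the normal angle is determined. *)
Lemma polar_unique x th lam ph mu : polar x th lam -> polar x ph mu ->
  lam = mu /\ cos (ph - th) = 1.
Proof.
move=> p1 p2; have [l0 e1 _] := p1; have [m0 e2 _] := p2.
have le (t s a b : R) : 0 < b -> polar x t a -> polar x s b -> b <= a.
  move=> b0 pa [_ e _]; have [a0 _ _] := pa.
  rewrite leNgt; apply/negP => ab; have := polar_le pa s.
  by rewrite e leNgt => /negP; apply; rewrite supp_lt // a0.
have lm : lam = mu by apply/eqP; rewrite eq_le (le _ _ _ _ l0 p2 p1) (le _ _ _ _ m0 p1 p2).
split=> //; have [m mm Hm] := rad_lower l0.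
have := polar_gap p1 Hm ph; rewrite e2 lm subrr pmulr_rle0 // subr_le0 => c1.
by apply/eqP; rewrite eq_le cos_le1.
Qed.

(** Implicit differentiation of the two equations of [polar] along a line, the continuity
    of the coordinates being known already. In the second equation [kl] is the derivative
    of [dsupp] in the scale. *)
Lemma polar_derive x th lam (v : 'rV[R]_2) (f m : R -> R) kl :
  polar x th lam -> jcont kl -> (forall t l : R, 0 < l -> is_derive l 1 (dsupp t) (kl t l)) ->
  f 0 = th -> m 0 = lam -> f e @[e --> (0 : R)] --> th -> m e @[e --> (0 : R)] --> lam ->
  (\forall e \near (0 : R), polar (x + e *: v) (f e) (m e)) ->
  let lv := 2 * ip v th * lam^-1 * radV th lam in
  is_derive (0 : R) 1 m lv /\ is_derive (0 : R) 1 f (radV th lam * (ipt v th - kl th lam * lv)).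
Proof.
move=> px ckl Dkl f0 m0 cf cm nearp lv; have [l0 e1 e2] := px.
pose H t l := supp t l - ip x t; pose Ht t l := dsupp t l - ipt x t.
pose Hl t l := l / 2 * rad t l; pose Kt t l := rad t l - supp t l + ip x t.
have DH : partials H Ht Hl.
  move=> t l ll; split.
    have D1 := is_derive_supp_th t ll; have D2 := is_derive_ip x t.
    pose s t := supp t l; have D3 : is_derive t 1 s (dsupp t l) by [].
    by rewrite /H -/(s _); apply: is_derive_eq.
  have D1 := is_derive_supp_lam t ll; rewrite /H.
  by apply: is_derive_eq; rewrite subr0.
have DK : partials Ht Kt kl.
  move=> t l ll; split.
    have D2 := is_derive_ipt x t.
    pose s t := dsupp t l; have D3 : is_derive t 1 s (rad t l - supp t l) by exact: is_derive_dsupp_th.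
    by rewrite /Ht -/(s _); apply: is_derive_eq; rewrite opprK.
  have D1 := Dkl t l ll; rewrite /Ht.
  by apply: is_derive_eq; rewrite subr0.
have cont_ip (w : 'rV[R]_2) : continuous (ip w) by move=> t; exact: is_derive_continuous (is_derive_ip w t).
have cont_ipt (w : 'rV[R]_2) : continuous (ipt w) by move=> t; exact: is_derive_continuous (is_derive_ipt w t).
have jamp g : tame g -> jcont g by move=> ag; exact: (jcont_tame hc hM P0 hrho ag).
have cHt : jcont Ht.
  by move=> t l ll; apply: cvgB; [exact: (jamp _ tame_dsupp)|exact: (jcont_angle (cont_ipt x))].
have cHl : jcont Hl.
  move=> t l ll; apply: cvgM; last exact: (jamp _ tame_rad).
  by apply: cvgM; [exact: cvg_snd|exact: cvg_cst].
have cKt : jcont Kt.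
  move=> t l ll; apply: cvgD; last exact: (jcont_angle (cont_ip x)).
  by apply: cvgB; [exact: (jamp _ tame_rad)|exact: (jamp _ tame_supp)].
have ex (g gt gl : R -> R -> R) : partials g gt gl -> exists p : R -> R * R, forall e, 0 < m e ->
    [/\ `|(p e).1 - th| <= `|f e - th|, `|(p e).2 - lam| <= `|m e - lam| &
     g (f e) (m e) - g th lam = gt (p e).1 (m e) * (f e - th) + gl th (p e).2 * (m e - lam)].
  move=> Dg; have ex1 e : exists pe : R * R, 0 < m e ->
      [/\ `|pe.1 - th| <= `|f e - th|, `|pe.2 - lam| <= `|m e - lam| &
       g (f e) (m e) - g th lam = gt pe.1 (m e) * (f e - th) + gl th pe.2 * (m e - lam)].
    have [me0|] := ltP 0 (m e); last by exists (0, 0).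
    have [xi [eta [h1 h2 _ E]]] := slope2 Dg th (f e) l0 me0.
    by exists (xi, eta).
  by have [p Hp] := choice ex1; exists p.
have [p Hp] := ex _ _ _ DH; have [q Hq] := ex _ _ _ DK.
have nearm : \forall e \near (0 : R), 0 < m e by apply: (cvgr_gt _ cm).
have cp1 : (p e).1 @[e --> (0 : R)] --> th.
  by apply: cvg_between cf; apply: filterS nearm => e me; have [] := Hp e me.
have cp2 : (p e).2 @[e --> (0 : R)] --> lam.
  by apply: cvg_between cm; apply: filterS nearm => e me; have [] := Hp e me.
have cq1 : (q e).1 @[e --> (0 : R)] --> th.
  by apply: cvg_between cf; apply: filterS nearm => e me; have [] := Hq e me.
have cq2 : (q e).2 @[e --> (0 : R)] --> lam.
  by apply: cvg_between cm; apply: filterS nearm => e me; have [] := Hq e me.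
pose A1 e := Ht (p e).1 (m e); pose B1 e := Hl th (p e).2.
pose A2 e := Kt (q e).1 (m e); pose B2 e := kl th (q e).2.
have cA1 : A1 e @[e --> (0 : R)] --> (0 : R).
  have z : Ht th lam = 0 by rewrite /Ht e2 subrr.
  rewrite -[X in _ --> X]z; exact: (jcont_cvg _ cHt).
have cB1 : B1 e @[e --> (0 : R)] --> lam / 2 * rad th lam.
  by apply: (jcont_cvg _ cHl) => //; exact: cvg_cst.
have cA2 : A2 e @[e --> (0 : R)] --> rad th lam.
  have z : Kt th lam = rad th lam by rewrite /Kt e1 subrK.
  rewrite -z; exact: (jcont_cvg _ cKt).
have cB2 : B2 e @[e --> (0 : R)] --> kl th lam.
  by apply: (jcont_cvg _ ckl) => //; exact: cvg_cst.
have c1 : ip v (f e) @[e --> (0 : R)] --> ip v th by exact: (cvg_comp _ _ cf (cont_ip v th)).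
have c2 : ipt v (f e) @[e --> (0 : R)] --> ipt v th by exact: (cvg_comp _ _ cf (cont_ipt v th)).
pose det e := A2 e * B1 e - A1 e * B2 e.
have r0 := rad_gt0 th l0.
have cdet : det e @[e --> (0 : R)] --> rad th lam * (lam / 2 * rad th lam) - 0 * kl th lam.
  by apply: cvgB; exact: cvgM.
rewrite mul0r subr0 in cdet.
have det0 : 0 < rad th lam * (lam / 2 * rad th lam) by rewrite mulr_gt0 // mulr_gt0 // divr_gt0.
(* The increments of the two coordinates solve a linear system whose coefficients are
   slopes, converging to partial derivatives; it is solved by Cramer's rule. The limit of
   [A1] is zero as [x] lies on the envelope, which makes the determinant nonzero. *)
have nearsys : \forall e \near (0 : R), [/\ det e != 0,
    A1 e * (f e - th) + B1 e * (m e - lam) = e * ip v (f e) &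
    A2 e * (f e - th) + B2 e * (m e - lam) = e * ipt v (f e)].
  have neardet : \forall e \near (0 : R), 0 < det e by apply: (cvgr_gt _ cdet).
  near=> e; have pe : polar (x + e *: v) (f e) (m e) by near: e.
  have [me0 E1 E2] := pe; split.
  - by apply: lt0r_neq0; near: e.
  - have [_ _ <-] := Hp e me0; rewrite /H -E1 e1 subrr subr0 /ip !mxE; ring.
  - have [_ _ <-] := Hq e me0; rewrite /Ht -E2 e2 subrr subr0 /ipt !mxE; ring.
split.
- apply: (@is_derive_slope _ m (fun e => (A2 e * ip v (f e) - A1 e * ipt v (f e)) / det e)).
    apply: filterS nearsys => e [de s1 s2]; rewrite m0 subr0.
    apply: (mulIf de); transitivity (A2 e * (e * ip v (f e)) - A1 e * (e * ipt v (f e))).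
      by rewrite -s1 -s2 /det; ring.
    by field.
  have -> : lv = (rad th lam * ip v th - 0 * ipt v th) / (rad th lam * (lam / 2 * rad th lam)).
    by rewrite /lv radVE; field; rewrite !lt0r_neq0.
  apply: cvgM; first by apply: cvgB; exact: cvgM.
  by apply: cvgV cdet; exact: lt0r_neq0.
- apply: (@is_derive_slope _ f (fun e => (B1 e * ipt v (f e) - B2 e * ip v (f e)) / det e)).
    apply: filterS nearsys => e [de s1 s2]; rewrite f0 subr0.
    apply: (mulIf de); transitivity (B1 e * (e * ipt v (f e)) - B2 e * (e * ip v (f e))).
      by rewrite -s1 -s2 /det; ring.
    by field.
  have -> : radV th lam * (ipt v th - kl th lam * lv) =
     (lam / 2 * rad th lam * ipt v th - kl th lam * ip v th) / (rad th lam * (lam / 2 * rad th lam)).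
    by rewrite /lv radVE; field; rewrite !lt0r_neq0.
  apply: cvgM; first by apply: cvgB; exact: cvgM.
  by apply: cvgV cdet; exact: lt0r_neq0.
Unshelve. all: by end_near. Qed.

Lemma dist1_cvg (x : 'rV[R]_2) : dist1 x y @[y --> x] --> (0 : R).
Proof.
have c i : (fun y : 'rV[R]_2 => `|y 0 i - x 0 i|) y @[y --> x] --> (0 : R).
  rewrite -[X in _ --> X](normr0 R) -[in X in _ --> X](subrr (x 0 i)).
  have c0 : (fun y : 'rV[R]_2 => y 0 i) y @[y --> x] --> x 0 i by exact: coord_continuous.
  exact: (cvg_norm (cvgB c0 (cvg_cst (x 0 i)))).
have := cvgD (c 0) (c 1); rewrite addr0; exact.
Qed.

Lemma cos_eq1 (b : R) : `|b| <= pi -> cos b = 1 -> b = 0.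
Proof.
move=> bpi; rewrite -cos_norm -cos0 => cb; apply/eqP; rewrite -normr_eq0; apply/eqP.
by apply: (@cos_inj R) cb; rewrite in_itv /= ?normr_ge0 ?bpi // lexx pi_ge0.
Qed.

(** * Coordinates off the body *)

Section body.
Variable C : set 'rV[R]_2.
Hypothesis Cclosed : closed C.
Hypothesis hsup : forall x, C x -> forall th, ip x th <= h0 th.
Hypothesis hsep : forall x, ~ C x -> exists th, h0 th < ip x th.

Lemma ip_bound (x : 'rV[R]_2) th : ip x th <= `|x 0 0| + `|x 0 1|.
Proof.
have := ip_dist 0 x th; rewrite /dist1 /ip !mxE !subr0 !mul0r addr0 subr0.
by apply: le_trans; rewrite ler_norm.
Qed.

(** From scale [1] on, the support function grows at least at the speed [rate 1] in all
    directions. *)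
Lemma supp_large (x : 'rV[R]_2) (a : R) : exists2 b, a < b & forall th, ip x th < supp th b.
Proof.
have [B B0 HB] := heat_bound hc hM 0.
pose K := weight 1 * B + `|x 0 0| + `|x 0 1| + 1.
have K0 : 0 < K.
  by rewrite /K ltr_wpDl // !addr_ge0 // mulr_ge0 // ltW // weight_gt0.
have r0 := rate_gt0 1.
exists (`|a| + 1 + K / rate 1) => [|th].
  rewrite -addrA (le_lt_trans (ler_norm a)) // ltrDl addr_gt0 // divr_gt0 //.
set b := _ + _ + _.
have b1 : 1 <= b by rewrite /b -addrA (addrCA _ 1) lerDl addr_ge0 // divr_ge0 // ltW.
have i1 : 0 < (1 : R) <= b by rewrite ltr01.
have gap := supp_gap th i1.
have kb : K <= rate 1 * (b - 1).
  have -> : rate 1 * (b - 1) = K + rate 1 * `|a|.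
    by rewrite /b; field; exact: lt0r_neq0.
  by rewrite lerDl mulr_ge0 // ltW.
have s1 : - (weight 1 * B) <= supp th 1.
  rewrite /supp -mulrN ler_pM2l ?weight_gt0 //.
  by have := HB th 1; rewrite ler_norml => /andP[].
by have := ip_bound x th; rewrite /K in kb; lra.
Qed.

(** Take the largest scale for which [x] is not strictly inside the curve. Then
    [supp - ip x] is nonnegative with a zero, and at this minimum its derivative vanishes,
    which is the second equation of [polar]. *)
Lemma exists_polar x : ~ C x -> exists th lam, polar x th lam.
Proof.
move=> /hsep[th1 hth1].
have [a a0 ha] : exists2 a : R, 0 < a & supp th1 a < ip x th1.
  have hn : \forall l \near (0 : R)^'+, supp th1 l < ip x th1.
    by apply: (cvgr_lt (h0 th1)) => //; exact: supp_cvg0.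
  near (0 : R)^'+ => l; exists l; first by near: l; exact: nbhs_right_gt.
  by near: l; exact: hn.
have [b ab hb] := supp_large x a.
(* The maximum with [a] only serves to keep [g] continuous on the whole plane. *)
pose g (z : R * R) := supp z.1 (Num.max z.2 a) - ip x z.1.
have cg : continuous g.
  move=> z; apply: cvgB; last first.
    have ci : {for z.1, continuous (ip x)} by exact: is_derive_continuous (is_derive_ip x _).
    have c1 : z'.1 @[z' --> z] --> z.1 by exact: cvg_fst.
    exact: (@cvg_comp _ _ _ _ (ip x) _ _ _ c1 ci).
  apply: (jcont_cvg _ (jcont_tame hc hM P0 hrho tame_supp)).
  - by rewrite lt_max a0 orbT.
  - exact: cvg_fst.
  - have cm : continuous (fun t : R => Num.max t a).
      by move=> t; apply: continuous_max; [exact: cvg_id|exact: cvg_cst].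
    have c1 : z'.2 @[z' --> z] --> z.2 by exact: cvg_snd.
    exact: (@cvg_comp _ _ _ _ (fun t : R => Num.max t a) _ _ _ c1 (cm z.2)).
pose Z := (`[- pi, pi]%classic `*` `[a, b]%classic) `&` (g @^-1` [set y | y <= 0]).
have cZ : compact Z.
  apply: compact_closedI; first by apply: compact_setX; exact: segment_compact.
  by move/continuous_closedP : cg; apply; exact: closed_le.
have rep (t : R) : exists2 k : int, (t + pi *+ 2 * k%:~R \in `[- pi, pi]%R) & True.
  by have [k] := angle_rep t; rewrite ler_norml => hk; exists k; rewrite // in_itv.
have perS l t (k : int) : supp (t + pi *+ 2 * k%:~R) l = supp t l.
  by rewrite (periodic_int (f := supp ^~ l)) // => y; exact: supp_periodic.
have perI t (k : int) : ip x (t + pi *+ 2 * k%:~R) = ip x t.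
  exact: periodic_int (ip_periodic x) _ _.
have inZ t l : a <= l <= b -> supp t l <= ip x t -> exists2 t', Z (t', l) & True.
  move=> /andP[al lb] h; have [k kI _] := rep t; exists (t + pi *+ 2 * k%:~R) => //.
  split; first by split => //=; rewrite in_itv /= al.
  by rewrite /= /g /= max_l // perS perI subr_le0.
have Z0 : Z !=set0.
  have [|t' Zt _] := inZ th1 a _ (ltW ha); first by rewrite lexx ltW.
  by exists (t', a).
have csnd : continuous (snd : R * R -> R) by move=> z; exact: cvg_snd.
have [[ths ls]] := compact_EVT_max Z0 cZ (continuous_subspaceT csnd).
rewrite inE => -[[/= _ lI] gs] maxs; move: lI gs; rewrite in_itv /= => /andP[als lsb].
rewrite /g /= max_l // subr_le0 => hs.
have ls0 : 0 < ls := lt_le_trans a0 als.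
have above t : ip x t <= supp t ls.
  rewrite leNgt; apply/negP => ht.
  have lsb' : ls < b.
    rewrite lt_neqAle lsb andbT; apply/eqP => E; have := hb t.
    by rewrite -E ltNge (ltW ht).
  have cs : {for ls, continuous (supp t)} by exact: is_derive_continuous (is_derive_supp_lam t ls0).
  have hn : \forall l \near ls^'+, supp t l < ip x t.
    apply: (cvgr_lt (supp t ls)) => //; exact: cvg_at_right_filter cs.
  near ls^'+ => l.
  have lsl : ls < l by near: l; exact: nbhs_right_gt.
  have lb : l <= b by near: l; exact: nbhs_right_le.
  have [||t' Zt _] := inZ t l; first by rewrite lb (le_trans als) // ltW.
    by apply: ltW; near: l; exact: hn.
  have := maxs (t', l); rewrite inE => /(_ Zt) /=; by rewrite leNgt lsl.
exists ths, ls; split => //; first by apply/eqP; rewrite eq_le hs above.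
pose u t := supp t ls - ip x t; pose s t := supp t ls.
have Du (t : R) : is_derive t 1 u (dsupp t ls - ipt x t).
  have D1 : is_derive t 1 s (dsupp t ls) by exact: is_derive_supp_th.
  have D2 := is_derive_ip x t.
  by rewrite /u -/(s _); apply: is_derive_eq.
have us : u ths = 0 by apply/eqP; rewrite /u subr_eq0 eq_le hs above.
have D0 : is_derive ths 1 u 0.
  apply: (@derive1_at_min _ _ (ths - 1) (ths + 1)).
  - lra.
  - by move=> t _; case: (Du t).
  - by rewrite in_itv /=; apply/andP; split; lra.
  - by move=> t _; rewrite us /u subr_ge0.
have := @derive_val _ _ _ _ _ _ _ D0; rewrite (@derive_val _ _ _ _ _ _ _ (Du ths)).
by move/eqP; rewrite subr_eq0 => /eqP.
Unshelve. all: by end_near. Qed.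

Lemma polar_notin x th lam : polar x th lam -> ~ C x.
Proof.
move=> [l0 e1 _] /hsup /(_ th); rewrite e1 leNgt => /negP; apply.
exact: supp_gt.
Qed.

Lemma line_cvg (x v : 'rV[R]_2) : x + e *: v @[e --> (0 : R)] --> x.
Proof.
have c : (fun e : R => e *: v) e @[e --> (0 : R)] --> (0 : R) *: v.
  by apply: cvgZ; [exact: cvg_id|exact: cvg_cst].
have FF : Filter (nbhs (0 : R)) := nbhs_filter _.
have c0 : (fun e : R => x) e @[e --> (0 : R)] --> x by exact: cvg_cst.
have := cvgD c0 c => /(_ FF).
by rewrite scale0r addr0.
Qed.

Definition coord (x : 'rV[R]_2) : R * R := xget (0, 0) [set c | polar x c.1 c.2].

Lemma coordP x : ~ C x -> polar x (coord x).1 (coord x).2.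
Proof.
move=> /exists_polar[th [lam p]].
by apply: (@xgetPex _ (0, 0) [set c | polar x c.1 c.2]); exists (th, lam).
Qed.

(** The angle chosen by [coord] may jump by a full turn; the representative closest to a
    given angle depends continuously on the point, see [lift_cvg]. *)
Definition lift (th : R) (y : 'rV[R]_2) : R := (coord y).1 +
  pi *+ 2 * (xget 0 [set k : int | `|(coord y).1 - th + pi *+ 2 * k%:~R| <= pi])%:~R.

Lemma lift_near th y : `|lift th y - th| <= pi.
Proof.
rewrite /lift addrAC.
by apply: (@xgetPex _ 0 [set k : int | `|(coord y).1 - th + pi *+ 2 * k%:~R| <= pi]); exact: angle_rep.
Qed.

Lemma lift_polar th y : ~ C y -> polar y (lift th y) (coord y).2.
Proof. by move=> /coordP/polar_int; exact. Qed.

Lemma lift_eq x th lam : polar x th lam -> lift th x = th /\ (coord x).2 = lam.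
Proof.
move=> px; have nC := polar_notin px.
have [-> c1] := polar_unique px (lift_polar th nC); split => //.
by apply/eqP; rewrite -subr_eq0 (cos_eq1 (lift_near th x) c1).
Qed.

Lemma near_notin x : ~ C x -> \forall y \near x, ~ C y.
Proof.
by move=> nC; apply: (@open_nbhs_nbhs _ x (~` C)); split => //; exact: closed_openC.
Qed.

Lemma near_dist1 (x : 'rV[R]_2) d : 0 < d -> \forall y \near x, dist1 x y < d.
Proof. have FF : Filter (nbhs x) := nbhs_filter _.
by move=> d0; exact: (cvgr_lt 0 (@dist1_cvg x) d d0). Qed.

Lemma coord_cvg x th lam : polar x th lam -> (coord y).2 @[y --> x] --> lam.
Proof.
move=> px; have nC := polar_notin px; have FF : Filter (nbhs x) := nbhs_filter _.
apply/cvgrPdist_lt => e e0.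
have [d d0 Hd] := polar_scale_stable px e0.
apply: filterS2 (near_notin nC) (near_dist1 x d0) => y nCy dy.
by rewrite distrC; exact: Hd (coordP nCy) dy.
Qed.

Lemma lift_cvg x th lam : polar x th lam -> lift th y @[y --> x] --> th.
Proof.
move=> px; have nC := polar_notin px; have FF : Filter (nbhs x) := nbhs_filter _.
apply/cvgrPdist_lt => e e0.
have e'0 : 0 < 1 - cos (Num.min e pi) :> R.
  rewrite subr_gt0 -cos0 ltr_cos ?in_itv /= ?lexx ?pi_ge0 //.
    by rewrite lt_min e0 pi_gt0.
  by rewrite le_min (ltW e0) pi_ge0 /= ge_min lexx orbT.
have [d d0 Hd] := polar_angle_stable px e'0.
apply: filterS2 (near_notin nC) (near_dist1 x d0) => y nCy dy.
rewrite distrC; apply: cos_lt => //; first exact: lift_near.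
exact: Hd (lift_polar th nCy) dy.
Qed.

(** Turns a function of the coordinates into a function on the plane that vanishes on the
    body. *)
Definition of_coord (a : R -> R -> R) (x : 'rV[R]_2) : R :=
  if `[< C x >] then 0 else a (coord x).1 (coord x).2.

Lemma of_coord_in a x : C x -> of_coord a x = 0.
Proof. by move=> Cx; rewrite /of_coord asboolT. Qed.

Lemma of_coord_polar a x th lam : (forall t l, a (t + pi *+ 2) l = a t l) ->
  polar x th lam -> of_coord a x = a th lam.
Proof.
move=> pa px; have nC := polar_notin px; rewrite /of_coord asboolF //.
have [lE _] := lift_eq px; have [_ mE] := lift_eq px.
have := periodic_int (f := a ^~ (coord x).2) (fun t => pa t _) (coord x).1.
by rewrite -mE -[in RHS]lE /lift => ->.
Qed.

Lemma of_coord_near a x th lam : (forall t l, a (t + pi *+ 2) l = a t l) ->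
  polar x th lam -> \forall y \near x, of_coord a y = a (lift th y) (coord y).2.
Proof.
move=> pa px; apply: filterS (near_notin (polar_notin px)) => y nCy.
exact: of_coord_polar pa (lift_polar th nCy).
Qed.

Lemma of_coord_cvg a x th lam : (forall t l, a (t + pi *+ 2) l = a t l) -> jcont a ->
  polar x th lam -> of_coord a y @[y --> x] --> of_coord a x.
Proof.
move=> pa ca px; rewrite (of_coord_polar pa px); have [l0 _ _] := px.
have FF : Filter (nbhs x) := nbhs_filter _.
have c := jcont_cvg FF ca l0 (lift_cvg px) (coord_cvg px).
apply: cvg_trans c; apply: near_eq_cvg.
by apply: filterS (of_coord_near pa px) => y ->.
Qed.

Variable kl : R -> R -> R.
Hypothesis akl : tame kl.
Hypothesis Dkl : forall t l : R, 0 < l -> is_derive l 1 (dsupp t) (kl t l).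

(** The derivatives of the two coordinates in the direction [v], as found in
    [polar_derive]. *)
Definition scale_dir (v : 'rV[R]_2) (th lam : R) : R := 2 * ip v th * lam^-1 * radV th lam.
Definition angle_dir (v : 'rV[R]_2) (th lam : R) : R :=
  radV th lam * (ipt v th - kl th lam * scale_dir v th lam).

Lemma of_coord_derive (a at' al : R -> R -> R) x th lam v :
  (forall t l, a (t + pi *+ 2) l = a t l) -> chain a at' al -> polar x th lam ->
  is_derive x v (of_coord a) (at' th lam * angle_dir v th lam + al th lam * scale_dir v th lam).
Proof.
move=> pa ca px; have [l0 _ _] := px; apply: is_derive_line.
pose f e := lift th (x + e *: v); pose m e := (coord (x + e *: v)).2.
have xl := @line_cvg x v.
have cf : f e @[e --> (0 : R)] --> th by exact: (cvg_comp _ _ xl (lift_cvg px)).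
have cm : m e @[e --> (0 : R)] --> lam by exact: (cvg_comp _ _ xl (coord_cvg px)).
have [f0 m0] : f 0 = th /\ m 0 = lam by rewrite /f /m scale0r addr0; exact: lift_eq.
have np : \forall e \near (0 : R), polar (x + e *: v) (f e) (m e).
  have FF : Filter (nbhs (0 : R)) := nbhs_filter _.
  have np0 : \forall e \near (0 : R), ~ C (x + e *: v) := xl _ (near_notin (polar_notin px)).
  by apply: filterS np0 => e nC; exact: lift_polar.
have [Dm Df] := polar_derive px (jcont_tame hc hM P0 hrho akl) Dkl f0 m0 cf cm np.
have m00 : 0 < m 0 by rewrite m0.
have := ca f m 0 _ _ m00 Df Dm; rewrite f0 m0; apply: near_eq_is_derive.
by apply: filterS np => e pe; rewrite (of_coord_polar pa pe).
Qed.

(** * The potential and its smoothness *)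

Definition flat (lam : R) : R := expR (- lam^-1 ^+ 4).
(** The potential is [pot (fun _ _ => 1)], and its iterated partial derivatives are all of
    the form [pot g] with [g] tame. *)
Definition pot (g : R -> R -> R) := of_coord (fun th lam => flat lam * g th lam).

Lemma flat_periodic g : tame g -> forall t l, flat l * g (t + pi *+ 2) l = flat l * g t l.
Proof. by move=> ag t l; rewrite (tame_periodic hper ag). Qed.

Lemma tame_flatM g : tame g -> tame (fun th lam => flat lam * g th lam).
Proof. by move=> ag; apply: tame_mul => //; exact: tame_flat. Qed.

Lemma chain_flat g gt gl : chain g gt gl ->
  chain (fun th lam => flat lam * g th lam) (fun th lam => flat lam * gt th lam)
    (fun th lam => flat lam * (4 * lam^-1 ^+ 5 * g th lam + gl th lam)).
Proof.
move=> cg f m t a b m0 Df Dm; have D1 := cg _ _ _ _ _ m0 Df Dm.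
have Di := is_derive_inv (lt0r_neq0 m0).
rewrite /flat; apply: is_derive_eq; rewrite /GRing.scale /= expr2 invfM; ring.
Qed.

(** If [y] has scale [l], its distance to the body is at least the gap between the curves
    of scales [l / 2] and [l], which is of order [l * exp (- 4 * pi ^ 2 / l ^ 2)]. The factor
    [flat l = exp (- 1 / l ^ 4)] is so small that it makes up both for the square of this
    quantity and for the growth of [g]. *)
Lemma pot_small g : tame g -> exists K d : R, [/\ 0 <= K, 0 < d &
  forall x y, C x -> dist1 x y < d -> `|pot g y| <= K * dist1 x y ^+ 2].
Proof.
move=> ag; have [B [K [B0 K0 HB]]] := tame_growth hc hM P0 hrho ag.
pose c : R := (Num.sqrt pi)^-1 * P / 4.
have c0 : 0 < c by rewrite divr_gt0 // mulr_gt0 // invr_gt0.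
(* With [z = 1 / l ^ 2], the exponent to be beaten is [K * z] from the growth of [g], [8 *
   pi ^ 2 * z] from the squared distance and [z] from the factor [l ^ 2]; completing the
   square bounds [q * z - z ^ 2] by [q ^ 2 / 4]. *)
pose q : R := K + 8 * pi ^+ 2 + 1.
have d0 : 0 < rate (2^-1) * 2^-1 by rewrite mulr_gt0 ?rate_gt0 // invr_gt0.
exists (B * expR (q ^+ 2 / 4) / c ^+ 2), (rate (2^-1) * 2^-1); split => //.
  by rewrite divr_ge0 ?sqr_ge0 // mulr_ge0 ?expR_ge0.
move=> x y Cx dxy; have dd : 0 <= dist1 x y by rewrite addr_ge0.
have [Cy|nCy] := pselect (C y).
  by rewrite /pot of_coord_in // normr0 mulr_ge0 ?sqr_ge0 // divr_ge0 ?sqr_ge0 // mulr_ge0 ?expR_ge0.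
set th := (coord y).1; set l := (coord y).2.
have py : polar y th l := coordP nCy.
have [l0 e1 _] := py.
have gapd m : 0 < m < l -> supp th l - supp th m <= dist1 x y.
  move=> /andP[m0 ml]; have := hsup Cx th; have := supp_gt th m0.
  by have := le_trans (ler_norm _) (ip_dist x y th); rewrite e1; lra.
have l1 : l < 1.
  rewrite ltNge; apply/negP => l1.
  have i1 : 0 < (2^-1 : R) < l by rewrite invr_gt0 ltr0n /= (lt_le_trans _ l1) // invf_lt1 // ltr1n.
  have i2 : 0 < (2^-1 : R) <= 1 by rewrite invr_gt0 ltr0n /= invf_le1 // ler1n.
  have i3 : 0 < (1 : R) <= l by rewrite ltr01.
  have h1 := gapd _ i1; have h2 := supp_gap th i2; have h3 := supp_le th i3.
  have h4 : (1 : R) - 2^-1 = 2^-1 by field.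
  by rewrite h4 in h2; lra.
have l20 : 0 < l / 2 by rewrite divr_gt0.
have i1 : 0 < l / 2 < l by rewrite l20 /= gtr_pMr // invf_lt1 // ltr1n.
have i2 : 0 < l / 2 <= l by case/andP: i1 => -> /ltW ->.
have lower : c * (expR (- (4 * pi ^+ 2 * l^-1 ^+ 2)) * l) <= dist1 x y.
  apply: le_trans (gapd _ i1); apply: le_trans (supp_gap th i2).
  rewrite le_eqVlt; apply/orP; left; apply/eqP; rewrite /rate.
  have -> : - (pi / (l / 2)) ^+ 2 = - (4 * pi ^+ 2 * l^-1 ^+ 2) :> R.
    by field; exact: lt0r_neq0.
  by rewrite /c; field; exact: lt0r_neq0.
have lower0 : 0 <= c * (expR (- (4 * pi ^+ 2 * l^-1 ^+ 2)) * l).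
  by rewrite mulr_ge0 ?(ltW c0) // mulr_ge0 ?expR_ge0 // ltW.
have lower2 : (c * (expR (- (4 * pi ^+ 2 * l^-1 ^+ 2)) * l)) ^+ 2 <= dist1 x y ^+ 2.
  by apply: lerXn2r lower; rewrite nnegrE.
rewrite /pot /of_coord asboolF // -/th -/l normrM gtr0_norm ?expR_gt0 //.
have gB := HB th l; rewrite l0 (ltW l1) in gB; have {}gB := gB isT.
apply: (@le_trans _ _ (flat l * (B * expR (K * l^-1 ^+ 2)))).
  by rewrite ler_pM2l ?expR_gt0.
apply: (@le_trans _ _ (B * expR (q ^+ 2 / 4) / c ^+ 2 *
    (c * (expR (- (4 * pi ^+ 2 * l^-1 ^+ 2)) * l)) ^+ 2)); last first.
  by apply: ler_wpM2l lower2; rewrite divr_ge0 ?sqr_ge0 // mulr_ge0 ?expR_ge0.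
set z := l^-1 ^+ 2.
have zl : expR (- z) <= l ^+ 2.
  rewrite expRN -[leRHS]invrK lef_pV2 ?posrE ?expR_gt0 ?invr_gt0 ?exprn_gt0 //.
  by apply: le_trans (expR_ge1Dx z); rewrite /z exprVn lerDr.
have -> : B * expR (q ^+ 2 / 4) / c ^+ 2 * (c * (expR (- (4 * pi ^+ 2 * z)) * l)) ^+ 2 =
    B * (expR (q ^+ 2 / 4 - 8 * pi ^+ 2 * z) * l ^+ 2).
  have -> : q ^+ 2 / 4 - 8 * pi ^+ 2 * z =
    q ^+ 2 / 4 + (- (4 * pi ^+ 2 * z) + - (4 * pi ^+ 2 * z)) by ring.
  by rewrite !expRD; field; exact: lt0r_neq0.
rewrite mulrCA ler_wpM2l //.
apply: (@le_trans _ _ (expR (q ^+ 2 / 4 - 8 * pi ^+ 2 * z) * expR (- z))); last first.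
  by rewrite ler_pM2l ?expR_gt0.
rewrite /flat -!expRD ler_expR (_ : l^-1 ^+ 4 = z ^+ 2); last by rewrite /z -exprM.
have := sqr_ge0 (z - q / 2); rewrite /q; lra.
Qed.

Lemma pot_cvg g x : tame g -> pot g y @[y --> x] --> pot g x.
Proof.
move=> ag; have [Cx|nCx] := pselect (C x); last first.
  exact: of_coord_cvg (flat_periodic ag) (jcont_tame hc hM P0 hrho (tame_flatM ag)) (coordP nCx).
have [K [d [K0 d0 HK]]] := pot_small ag.
have FF : Filter (nbhs x) := nbhs_filter _.
rewrite /pot (of_coord_in _ Cx); apply/cvgrPdist_lt => e e0.
have cK : K * dist1 x y ^+ 2 @[y --> x] --> (0 : R).
  have cd := dist1_cvg x.
  have := cvgM (cvg_cst K) (cvgM cd cd).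
  by rewrite !mulr0; exact.
have nK : \forall y \near x, K * dist1 x y ^+ 2 < e by exact: (cvgr_lt 0 cK e e0).
apply: filterS2 nK (near_dist1 x d0) => y Ky dy.
by rewrite sub0r normrN (le_lt_trans _ Ky) // HK.
Qed.

Lemma pot_derive_in g x v : tame g -> C x -> is_derive x v (pot g) 0.
Proof.
move=> ag Cx; have [K [d [K0 d0 HK]]] := pot_small ag.
apply: is_derive_line.
apply: (@is_derive_slope _ _ (fun e => pot g (x + e *: v) / e)).
  apply/nbhs_ballP; exists 1 => //= e _; rewrite scale0r addr0 {2}/pot (of_coord_in _ Cx) !subr0.
  have [->|e0] := eqVneq e 0; last by rewrite divfK.
  by rewrite scale0r addr0 /pot (of_coord_in _ Cx) mulr0.
pose D := `|v 0 0| + `|v 0 1|.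
have dE e : dist1 x (x + e *: v) = `|e| * D.
  by rewrite /dist1 !mxE ![x _ _ + _]addrC !addrK !normrM -mulrDr.
apply/cvgrPdist_lt => eps eps0.
have cK : K * D ^+ 2 * `|e| @[e --> (0 : R)] --> (0 : R).
  have := cvgM (cvg_cst (K * D ^+ 2)) (cvg_norm (cvg_id (F := nbhs (0 : R)))).
  move=> /(_ (nbhs_filter _) (nbhs_filter _) (nbhs_filter _)).
  by rewrite normr0 mulr0.
have nK : \forall e \near (0 : R), K * D ^+ 2 * `|e| < eps by exact: (cvgr_lt 0 cK eps eps0).
have nd : \forall e \near (0 : R), dist1 x (x + e *: v) < d.
  exact: (@line_cvg x v _ (near_dist1 x d0)).
apply: filterS2 nK nd => e Ke de; rewrite sub0r normrN (le_lt_trans _ Ke) //.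
have [->|e0] := eqVneq e 0; first by rewrite invr0 mulr0 normr0 mulr0.
rewrite normrM normfV ler_pdivrMr ?normr_gt0 //.
apply: le_trans (HK _ _ Cx de) _; rewrite dE exprMn.
by rewrite le_eqVlt; apply/orP; left; apply/eqP; ring.
Qed.

(** The term with [lam^-1 ^+ 5] stems from the logarithmic derivative of [flat]. *)
Definition dir_derivative (v : 'rV[R]_2) (g gt gl : R -> R -> R) (th lam : R) : R :=
  gt th lam * angle_dir v th lam +
  (4 * lam^-1 ^+ 5 * g th lam + gl th lam) * scale_dir v th lam.

Lemma tame_ip v : tame (fun th _ => ip v th).
Proof.
by apply: tame_add; apply: tame_mul; try exact: tame_cst; [exact: tame_cos|exact: tame_sin].
Qed.

Lemma tame_ipt v : tame (fun th _ => ipt v th).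
Proof.
have -> : (fun th _ : R => ipt v th) = (fun th _ => v 0 1 * cos th + - v 0 0 * sin th).
  by apply/funext => th; apply/funext => _; rewrite /ipt mulNr.
by apply: tame_add; apply: tame_mul; try exact: tame_cst; [exact: tame_cos|exact: tame_sin].
Qed.

Lemma tame_scale_dir v : tame (scale_dir v).
Proof.
apply: tame_mul; last exact: tame_radV.
apply: tame_mul; last exact: tame_scaleV.
by apply: tame_mul; [exact: tame_cst|exact: tame_ip].
Qed.

Lemma tame_angle_dir v : tame (angle_dir v).
Proof.
have -> : angle_dir v = (fun th lam => radV th lam * (ipt v th + -1 * (kl th lam * scale_dir v th lam))).
  by apply/funext => th; apply/funext => lam; rewrite mulN1r.
apply: tame_mul; first exact: tame_radV.
apply: tame_add; first exact: tame_ipt.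
apply: tame_mul; first exact: tame_cst.
by apply: tame_mul => //; exact: tame_scale_dir.
Qed.

Lemma tame_dir_derivative v g gt gl : tame g -> tame gt -> tame gl -> tame (dir_derivative v g gt gl).
Proof.
move=> ag agt agl; apply: tame_add.
  by apply: tame_mul => //; exact: tame_angle_dir.
apply: tame_mul; last exact: tame_scale_dir.
apply: tame_add => //; apply: tame_mul => //.
by apply: tame_mul; [exact: tame_cst|exact: tame_scaleVn].
Qed.

Lemma pot_derive v g gt gl x : tame g -> tame gt -> tame gl -> chain g gt gl ->
  is_derive x v (pot g) (pot (dir_derivative v g gt gl) x).
Proof.
move=> ag agt agl cg; have [Cx|nCx] := pselect (C x).
  by rewrite {2}/pot of_coord_in //; exact: pot_derive_in.
have px := coordP nCx.
have := of_coord_derive v (flat_periodic ag) (chain_flat cg) px.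
congr is_derive.
rewrite /pot (of_coord_polar (flat_periodic (tame_dir_derivative v ag agt agl)) px) /dir_derivative; ring.
Qed.

Lemma class_C_pot k g : tame g -> class_C k (pot g).
Proof.
elim: k g => [|k IHk] g ag; split => //; try by move=> x; exact: pot_cvg.
move=> i; have [gt [gl [agt agl cg]]] := tame_chain hc hM P0 hrho ag.
have D x := pot_derive (delta_mx 0 i) x ag agt agl cg.
split=> [x|]; first by case: (D x).
have -> : partial i (pot g) = pot (dir_derivative (delta_mx 0 i) g gt gl).
  by apply/funext => x; rewrite /partial (@derive_val _ _ _ _ _ _ _ (D x)).
exact/IHk/tame_dir_derivative.
Qed.

Let U := pot (fun _ _ => 1).

(** * Level orbits *)

Definition normal_vec (th : R) : 'rV[R]_2 := \row_i (if i == 0 then cos th else sin th).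

Lemma ip_delta (i : 'I_2) th : ip (delta_mx 0 i) th = normal_vec th 0 i.
Proof.
by rewrite /ip !mxE eqxx /=; case: (ord2 i) => -> /=; rewrite mul1r mul0r ?addr0 ?add0r.
Qed.

(** The gradient is normal to the curves, and up to a factor depending on [lam] alone its
    size is the curvature of the curve: this is what the flow was chosen for. *)
Lemma grad_pot x th lam : polar x th lam ->
  grad U x = (8 * lam^-1 ^+ 6 * flat lam * radV th lam) *: normal_vec th.
Proof.
move=> px; apply/rowP => i; rewrite !mxE /partial.
have c1 : chain (fun _ _ => 1) (fun _ _ => 0) (fun _ _ => 0 : R) 
  by exact: (@chain_angle _ (cst 1) (cst 0)).
have a1 := tame_cst h0 1; have a0 := tame_cst h0 0.
have D := pot_derive (delta_mx 0 i) x a1 a0 a0 c1.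
rewrite (@derive_val _ _ _ _ _ _ _ D) /pot.
rewrite (of_coord_polar (flat_periodic (tame_dir_derivative _ a1 a0 a0)) px) /dir_derivative /scale_dir ip_delta.
by rewrite /normal_vec mxE; ring.
Qed.

Lemma grad_pot_in x : C x -> grad U x = 0.
Proof.
move=> Cx; apply/rowP => i; rewrite !mxE /partial.
have D := pot_derive_in (delta_mx 0 i) (tame_cst h0 1) Cx.
by rewrite (@derive_val _ _ _ _ _ _ _ D).
Qed.

Lemma normal_vec_neq0 th : normal_vec th != 0.
Proof.
apply/eqP => /rowP E; have := E 0; have := E 1; rewrite !mxE /= => s c.
by have := cos2Dsin2 th; rewrite s c expr0n addr0 => /eqP; rewrite eq_sym oner_eq0.
Qed.

Lemma crit_pot : crit U = C.
Proof.
apply/seteqP; split => x; last exact: grad_pot_in.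
move=> gx; apply: contrapT => /coordP px; have [l0 _ _] := px.
move: gx; rewrite /crit /= (grad_pot px) => /eqP; rewrite scaler_eq0 (negbTE (normal_vec_neq0 _)) orbF.
rewrite gt_eqF // radVE !mulr_gt0 ?expR_gt0 ?exprn_gt0 ?invr_gt0 //.
exact: rad_gt0.
Qed.

Lemma U_polar x th lam : polar x th lam -> U x = flat lam.
Proof. by move=> px; rewrite /U /pot (of_coord_polar (flat_periodic (tame_cst h0 1)) px) mulr1. Qed.

(** The orbit runs along the curve of scale [lam] with the constant speed [v] for which the
    centripetal acceleration [v ^ 2 / rad] is the size of the gradient. The normal angle
    then solves [psi' = v / rad], which has a solution for all times, so that maximality is
    automatic. *)
Lemma level_orbit_off x : ~ C x -> exists q, level_orbit U setT q /\ q 0 = x.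
Proof.
move=> /coordP; set th0 := (coord x).1; set lam := (coord x).2 => px; have [l0 e1 e2] := px.
pose v := Num.sqrt (8 * lam^-1 ^+ 6 * flat lam).
have v2 : v ^+ 2 = 8 * lam^-1 ^+ 6 * flat lam.
  by rewrite /v sqr_sqrtr // !mulr_ge0 ?exprn_ge0 ?invr_ge0 ?expR_ge0 // ltW.
pose s t := supp t lam; pose ds t := dsupp t lam; pose r t := rad t lam.
have Ds (t : R) : is_derive t 1 s (ds t) by exact: is_derive_supp_th.
have Dds (t : R) : is_derive t 1 ds (r t - s t) by exact: is_derive_dsupp_th.
have cs : continuous s by move=> t; exact: is_derive_continuous (Ds t).
have [S DS] := antiderivative cs.
have [m m0 Hm] := rad_lower l0.
(* As [rad = supp + supp''], an antiderivative of [supp] plus [supp'] is the arc length. *)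
have DL (t : R) : is_derive t 1 (fun t => S t + ds t) (r t).
  by apply: is_derive_eq; rewrite addrC subrK.
have [g Hg] := inverse_flow m0 DL Hm.
pose psi t := g (v * t + (S th0 + ds th0)).
have r0 t : r t != 0 by apply: lt0r_neq0; exact: lt_le_trans (Hm t).
have Dpsi (t : R) : is_derive t 1 psi (v / r (psi t)).
  have [_ D1] := Hg (v * t + (S th0 + ds th0)).
  by rewrite /psi; apply: is_derive_eq; rewrite /GRing.scale /=; ring.
have psi0 : psi 0 = th0.
  have [E _] := Hg (S th0 + ds th0); rewrite /psi mulr0 add0r.
  apply/eqP; rewrite eq_le; apply/andP; split; rewrite leNgt; apply/negP => H.
    have [c _] := mvt H (fun x _ => DL x); rewrite E subrr => /esym/eqP.
    by rewrite mulf_eq0 (negbTE (r0 _)) /= subr_eq0 gt_eqF.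
  have [c _] := mvt H (fun x _ => DL x); rewrite E subrr => /esym/eqP.
  by rewrite mulf_eq0 (negbTE (r0 _)) /= subr_eq0 gt_eqF.
pose q t := point (psi t) lam.
have pq t : polar (q t) (psi t) lam by exact: polar_point.
pose dq t : 'rV[R]_2 := v *: \row_i (if i == 0 then - sin (psi t) else cos (psi t)).
have Dq (t : R) : is_derive t 1 q (dq t).
  apply: is_derive_row => i; rewrite /q /point /dq !mxE.
  have D1 := Ds (psi t); have D2 := Dds (psi t); have D3 := Dpsi t; have rn := r0 (psi t).
  under eq_fun do rewrite mxE.
  by have [? ?] := is_derive_envelope_point D1 D2 D3 rn; case: (i == 0).
have q1 : q^`() = dq by apply/funext => t; rewrite derive1E (@derive_val _ _ _ _ _ _ _ (Dq t)).
have Ddq (t : R) : is_derive t 1 dq (- grad U (q t)).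
  rewrite (grad_pot (pq t)) radVE -v2.
  apply: is_derive_row => i; rewrite /dq !mxE.
  have D3 := Dpsi t; have rn := r0 (psi t).
  under eq_fun do rewrite !mxE.
  case: (i == 0).
    by apply: is_derive_eq; rewrite /GRing.scale /= -/(r _); field.
  by apply: is_derive_eq; rewrite /GRing.scale /= -/(r _); field.
exists q; split.
  apply: level_orbit_total.
  - by move=> t; case: (Dq t).
  - by move=> t; rewrite q1; case: (Ddq t).
  - by move=> t; rewrite derive1nS derive1n1 q1 derive1E (@derive_val _ _ _ _ _ _ _ (Ddq t)).
  - by move=> t t'; rewrite !(U_polar (pq _)).
have ct := cos2Dsin2 th0.
apply: row2P; rewrite /q psi0 /point mxE -e1 -e2 /ip /ipt /=.
- by rewrite -[RHS]mulr1 -ct; ring.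
- by rewrite -[RHS]mulr1 -ct; ring.
Qed.

Lemma Levi_pot : Levi_potential U /\ crit U = C.
Proof.
split; last exact: crit_pot.
split; first by move=> k; apply: class_C_pot; exact: tame_cst.
move=> x; exists setT; have [Cx|nCx] := pselect (C x).
  by exists (cst x); split; [apply: level_orbit_cst; exact: grad_pot_in|exists 0].
by have [q [oq q0]] := level_orbit_off nCx; exists q; split => //; exists 0.
Qed.

End body.

(** The hypotheses on [C] say that it is the closed convex set with support function
    [h0]. *)
Lemma Levi_of_support (C : set 'rV[R]_2) : closed C ->
  (forall x, C x -> forall th, ip x th <= h0 th) ->
  (forall x, ~ C x -> exists th, h0 th < ip x th) ->
  exists U : 'rV[R]_2 -> R, Levi_potential U /\ crit U = C.
Proof.
move=> Ccl hsup hsep.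
have [kt [kl [_ akl ck]]] := tame_chain hc hM P0 hrho tame_dsupp.
eexists; apply: (@Levi_pot C Ccl hsup hsep kl akl) => t l l0.
exact: is_derive_chain_scale ck t l l0.
Qed.
End envelope.

(** * Support functions of compact convex sets *)

Section continuity.
Context {R : realType} {T : topologicalType}.
Implicit Types f g : T -> R.

Lemma contD f g : continuous f -> continuous g -> continuous (fun x => f x + g x).
Proof. by move=> cf cg x; exact: (cvgD (cf x) (cg x)). Qed.

Lemma contM f g : continuous f -> continuous g -> continuous (fun x => f x * g x).
Proof. by move=> cf cg x; exact: (cvgM (cf x) (cg x)). Qed.

Lemma cont_norm f : continuous f -> continuous (fun x => `|f x|).
Proof. by move=> cf x; exact: (cvg_norm (cf x)). Qed.

Lemma cont_cst (a : R) : continuous (fun _ : T => a).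
Proof. by move=> x; exact: cvg_cst. Qed.

End continuity.

Section support_function.
Context {R : realType} (C : set 'rV[R]_2).
Hypothesis C0 : C !=set0.
Hypothesis Ccompact : compact C.
Hypothesis Cconvex : convex_set C.

Lemma ip_continuous th : continuous (fun x : 'rV[R]_2 => ip x th).
Proof.
by apply: contD; apply: contM; [exact: coord_continuous|exact: cont_cst|
  exact: coord_continuous|exact: cont_cst].
Qed.

Lemma support_point th : exists y, C y /\ forall x, C x -> ip x th <= ip y th.
Proof.
have [y] := compact_EVT_max C0 Ccompact (continuous_subspaceT (@ip_continuous th)).
rewrite inE => Cy ymax; exists y; split => // x Cx.
by apply: ymax; rewrite inE.
Qed.

Lemma support_bound : exists B : R, forall x, C x -> `|x 0 0| + `|x 0 1| <= B.
Proof.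
have cn : continuous (fun x : 'rV[R]_2 => `|x 0 0| + `|x 0 1|).
  by apply: contD; apply: cont_norm; exact: coord_continuous.
have [y _ ymax] := compact_EVT_max C0 Ccompact (continuous_subspaceT cn).
by exists (`|y 0 0| + `|y 0 1|) => x Cx; apply: ymax; rewrite inE.
Qed.

Lemma unit_angle (a b : R) : a ^+ 2 + b ^+ 2 = 1 -> exists th, cos th = a /\ sin th = b.
Proof.
move=> ab; have a1 : -1 <= a <= 1.
  by rewrite -ler_norml -(@ler_pXn2r _ 2) ?nnegrE // expr1n real_normK ?num_real // -ab lerDl sqr_ge0.
have sb : sin (acos a) = `|b|.
  by rewrite sin_acos // -ab addrC addKr sqrtr_sqr.
have ca : cos (acos a) = a by apply: acosK; rewrite in_itv.
have [b0|b0] := leP 0 b.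
  by exists (acos a); rewrite ca sb ger0_norm.
by exists (- acos a); rewrite cosN sinN ca sb ltr0_norm ?opprK.
Qed.

Lemma convex_combination x y (t : R) : C x -> C y -> 0 <= t -> t <= 1 ->
  C (t *: x + (1 - t) *: y).
Proof.
move=> Cx Cy t0 t1; have := Cconvex (Itv01 t0 t1) (mem_set Cx) (mem_set Cy).
by rewrite inE.
Qed.

(** The separating direction points from the nearest point [z] of [C] to [x]. *)
Lemma separating_direction x : ~ C x ->
  exists2 z, C z & exists th, (forall y, C y -> ip y th <= ip z th) /\ ip z th < ip x th.
Proof.
move=> nCx; pose N (y : 'rV[R]_2) := (x 0 0 - y 0 0) ^+ 2 + (x 0 1 - y 0 1) ^+ 2.
have cN : continuous N.
  have c i : continuous (fun y : 'rV[R]_2 => x 0 i - y 0 i).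
    by move=> y; exact: (cvgB (cvg_cst (x 0 i)) (@coord_continuous _ _ _ 0 i y)).
  by apply: contD; apply: contM; exact: c.
have [z] := compact_EVT_min C0 Ccompact (continuous_subspaceT cN).
rewrite inE => Cz zmin.
set a := x 0 0 - z 0 0; set b := x 0 1 - z 0 1.
have N0 : 0 < a ^+ 2 + b ^+ 2.
  rewrite lt_neqAle addr_ge0 ?sqr_ge0 // andbT eq_sym paddr_eq0 ?sqr_ge0 // !sqrf_eq0 !subr_eq0.
  apply/negP => /andP[/eqP e0 /eqP e1]; apply: nCx; suff -> : x = z by [].
  exact: row2P.
have obtuse y : C y -> a * (y 0 0 - z 0 0) + b * (y 0 1 - z 0 1) <= 0.
  move=> Cy; rewrite leNgt; apply/negP => A0.
  set A := a * _ + _ in A0; set S := (y 0 0 - z 0 0) ^+ 2 + (y 0 1 - z 0 1) ^+ 2.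
  have S0 : 0 <= S by rewrite addr_ge0 // sqr_ge0.
  have AS0 : 0 < A + S by rewrite ltr_pwDl.
  (* If the angle at [z] were acute, moving from [z] towards [y] by the fraction [t] would
   decrease the distance to [x]; this [t] satisfies [t <= 1] and [t * S < 2 * A]. *)
pose t := A / (A + S).
  have t0 : 0 < t by rewrite divr_gt0.
  have t1 : t <= 1 by rewrite ler_pdivrMr // mul1r lerDl.
  have := zmin (t *: y + (1 - t) *: z); rewrite inE => /(_ (convex_combination Cy Cz (ltW t0) t1)).
  have -> : N (t *: y + (1 - t) *: z) = N z - t * (2 * A - t * S).
    by rewrite /N /A /S /a /b !mxE; ring.
  rewrite lerBrDr gerDl pmulr_rle0 // subr_le0 leNgt => /negP; apply.
  have tS : t * S <= A.
    have -> : t * S = A * (S / (A + S)) by rewrite /t mulrAC mulrA.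
    by rewrite ger_pMr // ler_pdivrMr // mul1r lerDr ltW.
  lra.
pose r := Num.sqrt (a ^+ 2 + b ^+ 2).
have r0 : 0 < r by rewrite sqrtr_gt0.
have r2 : r ^+ 2 = a ^+ 2 + b ^+ 2 by rewrite sqr_sqrtr // ltW.
have [|th [ct st]] := @unit_angle (a / r) (b / r).
  by rewrite !exprMn -mulrDl -r2 exprVn divff // expf_neq0 // gt_eqF.
exists z => //; exists th.
have ipE y y' : ip y th - ip y' th = r^-1 * (a * (y 0 0 - y' 0 0) + b * (y 0 1 - y' 0 1)).
  by rewrite /ip ct st; ring.
split=> [y Cy|]; first by rewrite -subr_le0 ipE pmulr_rle0 ?invr_gt0 // obtuse.
by rewrite -subr_gt0 ipE mulr_gt0 ?invr_gt0.
Qed.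

(** Two distinct points of [C] are needed for the perimeter [P] to be positive. The width
    of [C] in a direction is at least the length of the projection of [p1 - p2], and its
    integral over half a turn is [P]. *)
Lemma Levi_two_points p1 p2 : C p1 -> C p2 -> p1 <> p2 ->
  exists U : 'rV[R]_2 -> R, Levi_potential U /\ crit U = C.
Proof.
move=> Cp1 Cp2 p12.
have [top Htop] := choice support_point.
pose h0 th := ip (top th) th.
have Ctop th : C (top th) by have [] := Htop th.
have hsup x : C x -> forall th, ip x th <= h0 th by move=> Cx th; have [_] := Htop th; exact.
have [B HB] := support_bound.
have ipd (x : 'rV[R]_2) t s : C x -> ip x t - ip x s <= B * (`|cos t - cos s| + `|sin t - sin s|).
  move=> Cx; have -> : ip x t - ip x s = x 0 0 * (cos t - cos s) + x 0 1 * (sin t - sin s).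
    by rewrite /ip; ring.
  apply: le_trans (ler_norm _) _; apply: le_trans (ler_normD _ _) _; rewrite !normrM.
  have := HB x Cx; have := normr_ge0 (x 0 0); have := normr_ge0 (x 0 1).
  have := normr_ge0 (cos t - cos s); have := normr_ge0 (sin t - sin s); nra.
have hd t s : h0 t - h0 s <= B * (`|cos t - cos s| + `|sin t - sin s|).
  by apply: le_trans (ipd _ t s (Ctop t)); rewrite lerD2l lerN2; exact: hsup.
have hc : continuous h0.
  move=> t; apply/cvgrPdist_le => e e0.
  have c : B * (`|cos t - cos s| + `|sin t - sin s|) @[s --> t] --> B * (`|cos t - cos t| + `|sin t - sin t|).
    apply: cvgM; first exact: cvg_cst.
    apply: cvgD; apply: cvg_norm; apply: cvgB; try exact: cvg_cst;
      [exact: continuous_cos|exact: continuous_sin].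
  rewrite !subrr normr0 addr0 mulr0 in c.
  have nb : \forall s \near t, B * (`|cos t - cos s| + `|sin t - sin s|) < e by exact: (cvgr_lt 0 c e e0).
  apply: filterS nb => s /ltW se; rewrite ler_norml; apply/andP; split.
    rewrite lerNl opprB; apply: le_trans (hd s t) _.
    by rewrite distrC (distrC (sin s)).
  exact: le_trans (hd t s) se.
have hM t : `|h0 t| <= B.
  have ib x : `|ip x t| <= `|x 0 0| + `|x 0 1|.
    rewrite /ip (le_trans (ler_normD _ _)) // !normrM.
    by rewrite lerD // ler_piMr //; [exact: cos_max|exact: sin_max].
  exact: le_trans (ib _) (HB _ (Ctop t)).
have hper t : h0 (t + pi *+ 2) = h0 t.
  apply/eqP; rewrite eq_le; apply/andP; split.
    by rewrite {1}/h0 ip_periodic; exact: hsup.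
  by rewrite {1}/h0 -ip_periodic; exact: hsup.
have htrig t a : 2 * cos a * h0 t <= h0 (t + a) + h0 (t - a).
  apply: le_trans (lerD (hsup _ (Ctop t) (t + a)) (hsup _ (Ctop t) (t - a))).
  rewrite le_eqVlt; apply/orP; left; apply/eqP.
  by rewrite /h0 /ip !cosD !sinD cosN sinN; ring.
have [F DF] := antiderivative hc.
pose P := F (0 + pi *+ 2) - F 0.
have FP x : F (x + pi *+ 2) - F x = P.
  apply: (@is_derive_0_is_cst _ (fun x => F (x + pi *+ 2) - F x)) => t.
  have D1 := DF (t + pi *+ 2); have D2 := DF t.
  by apply: is_derive_eq; rewrite hper /GRing.scale /= addr0 mulr1 subrr.
pose Q x := F x + F (x + pi).
have QP x : Q (x + pi) - Q x = P.
  have E : x + pi + pi = x + pi *+ 2 by ring.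
  by rewrite -(FP x) /Q E; ring.
pose d : 'rV[R]_2 := p1 - p2.
(* [T] is an antiderivative of [ip d], and it changes sign after half a turn; hence
   [2 * T t] is, up to sign, an integral of [ip d] over half a turn. *)
pose T t := d 0 0 * sin t - d 0 1 * cos t.
have PT t : 2 * `|T t| <= P.
  have ipp x u : ip x (u + pi) = - ip x u :> R by rewrite /ip cosDpi sinDpi; ring.
  have DT (u : R) : is_derive u 1 T (ip d u).
    by rewrite /T; apply: is_derive_eq; rewrite /GRing.scale /= /ip; ring.
  have DQ (u : R) : is_derive u 1 Q (h0 u + h0 (u + pi)).
    have D1 := DF u; have D2 := DF (u + pi).
    by rewrite /Q; apply: is_derive_eq; rewrite /GRing.scale /= addr0 mulr1.
  have w1 u : ip d u <= h0 u + h0 (u + pi).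
    have -> : ip d u = ip p1 u + ip p2 (u + pi) by rewrite ipp /ip !mxE; ring.
    by rewrite lerD // hsup.
  have w2 u : - ip d u <= h0 u + h0 (u + pi).
    have -> : - ip d u = ip p2 u + ip p1 (u + pi) by rewrite ipp /ip !mxE; ring.
    by rewrite lerD // hsup.
  have tp : t <= t + pi by rewrite lerDl pi_ge0.
  have m1 : Q t - T t <= Q (t + pi) - T (t + pi).
    have D (u : R) : is_derive u 1 (fun u => Q u - T u) (h0 u + h0 (u + pi) - ip d u).
      by have D1 := DQ u; have D2 := DT u; apply: is_derive_eq.
    by apply: (nondecreasing_derive tp (fun u _ => D u)) => u _; rewrite subr_ge0.
  have m2 : Q t + T t <= Q (t + pi) + T (t + pi).
    have D (u : R) : is_derive u 1 (fun u => Q u + T u) (h0 u + h0 (u + pi) + ip d u).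
      by have D1 := DQ u; have D2 := DT u; apply: is_derive_eq.
    apply: (nondecreasing_derive tp (fun u _ => D u)) => u _.
    by have := w2 u; lra.
  have Tp : T (t + pi) = - T t by rewrite /T cosDpi sinDpi; ring.
  have := QP t; rewrite Tp in m1 m2.
  have -> : 2 * `|T t| = `|2 * T t| by rewrite normrM ger0_norm.
  by move=> qp; rewrite ler_norml; apply/andP; split; lra.
have P0 : 0 < P.
  rewrite ltNge; apply/negP => Pn.
  have T0 t : T t = 0.
    by apply/eqP; rewrite -normr_le0; have := PT t; lra.
  have d0 : d 0 0 = 0.
    by have := T0 (pi / 2); rewrite /T sin_pihalf cos_pihalf mulr1 mulr0 subr0.
  have d1 : d 0 1 = 0.
    by have := T0 0; rewrite /T sin0 cos0 mulr1 mulr0 sub0r => /eqP; rewrite oppr_eq0 => /eqP.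
  apply: p12; rewrite !mxE in d0 d1.
  by apply: row2P; apply/eqP; rewrite -subr_eq0; apply/eqP.
have hrho th lam : 0 < lam -> P / lam * expR (- (pi / lam) ^+ 2) <= rho h0 th lam.
  exact: (rho_lower_bound hc hM DF FP htrig th).
apply: (Levi_of_support hc hM hper P0 hrho) => //.
- by apply: compact_closed => //; exact: norm_hausdorff.
- move=> x /separating_direction[z Cz [th [zmax zx]]]; exists th.
  exact: le_lt_trans (zmax _ (Ctop th)) zx.
Qed.

End support_function.

(** * The case of a single point *)

Section point.
Context {R : realType} (c : 'rV[R]_2).

Lemma class_C_cst n k (a : R) : class_C k (fun _ : 'rV[R]_n => a).
Proof.
elim: k a => [|k IHk] a; split; try exact: cont_cst; first by [].
move=> i; split=> [x|]; first exact: derivable_cst.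
have -> : partial i (fun _ : 'rV[R]_n => a) = (fun _ => 0).
  by apply/funext => x; rewrite /partial derive_cst.
exact: IHk.
Qed.

Definition quadratic (x : 'rV[R]_2) : R := 2^-1 * ((x 0 0 - c 0 0) ^+ 2 + (x 0 1 - c 0 1) ^+ 2).

Lemma is_derive_coord (x v : 'rV[R]_2) i : is_derive x v (fun y : 'rV[R]_2 => y 0 i - c 0 i) (v 0 i).
Proof.
apply: is_derive_line; under eq_fun do rewrite !mxE.
by apply: is_derive_eq; rewrite /GRing.scale /=; ring.
Qed.

Lemma is_derive_quadratic (x v : 'rV[R]_2) : is_derive x v quadratic
  ((x 0 0 - c 0 0) * v 0 0 + (x 0 1 - c 0 1) * v 0 1).
Proof.
apply: is_derive_line; rewrite /quadratic; under eq_fun do rewrite !mxE.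
by apply: is_derive_eq; rewrite /GRing.scale /=; field.
Qed.

Lemma partial_quadratic i : partial i quadratic = (fun x => x 0 i - c 0 i).
Proof.
apply/funext => x; rewrite /partial.
rewrite (@derive_val _ _ _ _ _ _ _ (is_derive_quadratic x (delta_mx 0 i))) !mxE eqxx /=.
by case: (ord2 i) => -> /=; rewrite mulr1 mulr0 ?addr0 ?add0r.
Qed.

Lemma coord_sub_continuous i : continuous (fun x : 'rV[R]_2 => x 0 i - c 0 i).
Proof. by move=> x; exact: (cvgB (@coord_continuous _ _ _ 0 i x) (cvg_cst (c 0 i))). Qed.

Lemma smooth_quadratic : smooth quadratic.
Proof.
have cq : continuous quadratic.
  apply: contM; first exact: cont_cst.
  by apply: contD; apply: contM; exact: coord_sub_continuous.
have coordC k i : class_C k (fun x : 'rV[R]_2 => x 0 i - c 0 i).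
  case: k => [|k]; split => //; try exact: coord_sub_continuous.
  move=> j; split=> [x|]; first by case: (is_derive_coord x (delta_mx 0 j) i).
  have -> : partial j (fun x : 'rV[R]_2 => x 0 i - c 0 i) = (fun _ => (delta_mx 0 j : 'rV[R]_2) 0 i).
    by apply/funext => x; rewrite /partial (@derive_val _ _ _ _ _ _ _ (is_derive_coord x (delta_mx 0 j) i)).
  exact: class_C_cst.
case=> [|k]; split => // i; split=> [x|]; first by case: (is_derive_quadratic x (delta_mx 0 i)).
by rewrite partial_quadratic; exact: coordC.
Qed.

Lemma grad_quadratic x : grad quadratic x = x - c.
Proof. by apply/rowP => i; rewrite !mxE partial_quadratic. Qed.

Lemma Levi_point : exists U : 'rV[R]_2 -> R, Levi_potential U /\ crit U = [set c].
Proof.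
exists quadratic; split; last first.
  apply/seteqP; split => x; rewrite /crit /= grad_quadratic; first by move/eqP; rewrite subr_eq0 => /eqP.
  by move=> ->; rewrite subrr.
split; first exact: smooth_quadratic.
move=> x; pose a := x 0 0 - c 0 0; pose b := x 0 1 - c 0 1.
pose q t : 'rV[R]_2 := \row_i (c 0 i + (if i == 0 then a * cos t - b * sin t else a * sin t + b * cos t)).
pose dq t : 'rV[R]_2 := \row_i (if i == 0 then - a * sin t - b * cos t else a * cos t - b * sin t).
have Dq (t : R) : is_derive t 1 q (dq t).
  apply: is_derive_row => i; rewrite /q /dq !mxE; under eq_fun do rewrite mxE.
  by case: (i == 0); apply: is_derive_eq; rewrite /GRing.scale /=; ring.
have q1 : q^`() = dq by apply/funext => t; rewrite derive1E (@derive_val _ _ _ _ _ _ _ (Dq t)).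
have Ddq (t : R) : is_derive t 1 dq (- grad quadratic (q t)).
  rewrite grad_quadratic; apply: is_derive_row => i; rewrite /q /dq !mxE; under eq_fun do rewrite mxE.
  by case: (i == 0); apply: is_derive_eq; rewrite /GRing.scale /=; ring.
exists setT, q; split.
  apply: level_orbit_total.
  - by move=> t; case: (Dq t).
  - by move=> t; rewrite q1; case: (Ddq t).
  - by move=> t; rewrite derive1nS derive1n1 q1 derive1E (@derive_val _ _ _ _ _ _ _ (Ddq t)).
  - have E t : quadratic (q t) = 2^-1 * ((a ^+ 2 + b ^+ 2) * (cos t ^+ 2 + sin t ^+ 2)).
      by rewrite /quadratic /q !mxE /=; ring.
    by move=> s t; rewrite !E !cos2Dsin2.
exists 0 => //; apply: row2P; rewrite /q mxE cos0 sin0 /=.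
- by rewrite /a; ring.
- by rewrite /b; ring.
Qed.

End point.

Unset Implicit Arguments.

Theorem theorem3 (R : realType) (C : set 'rV[R]_2) (hC0 : C !=set0)
    (hCcompact : compact C) (hCconvex : convex_set C) :
  exists U : 'rV[R]_2 -> R, Levi_potential U /\ crit U = C.
Proof.
have [c Cc] := hC0.
have [[p [Cp pc]]|one] := pselect (exists p, C p /\ p <> c).
  exact: (Levi_two_points hC0 hCcompact hCconvex Cp Cc pc).
suff -> : C = [set c] by exact: Levi_point.
apply/seteqP; split => x; last by move=> ->.
by move=> Cx; apply: contrapT => xc; apply: one; exists x.
Qed.
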